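(* Let $k$ be a field. Then tensor products exist in the category $\mathrm{Hopf}_k$ of abelian Hopf algebras over $k$, i.e. any two objects of $\mathrm{Hopf}_k$ have a tensor product. If $k$ is perfect, then tensor products also exist in the category $\mathrm{AbSch}_k$ of affine abelian group schemes over $k$.
   Context: Let $\mathcal C$ be a category with finite products and $\mathrm{Ab}(\mathcal C)$ its category of abelian group objects. For $A,A',B\in \mathrm{Ab}(\mathcal C)$, a morphism $b\in \mathrm{Hom}_{\mathcal C}(A\times A',B)$ is called bilinear if the induced natural transformation $\mathrm{Hom}_{\mathcal C}(-,A)\times \mathrm{Hom}_{\mathcal C}(-,A')\to \mathrm{Hom}_{\mathcal C}(-,B)$ is bilinear (as a map of abelian groups on each object). The set of these is $\mathrm{Bil}(A,A';B)$. A tensor product of $A$ and $A'$ is an object $A\otimes A'\in\mathrm{Ab}(\mathcal C)$ with a bilinear morphism $a\colon A\times A'\to A\otimes A'$ in $\mathcal C$ such that $f\mapsto f\circ a$ is a natural isomorphism $\mathrm{Hom}_{\mathrm{Ab}(\mathcal C)}(A\otimes A',-)\to \mathrm{Bil}(A,A';-)$. $\mathrm{Hopf}_k$ is the category of abelian (i.e. bicommutative) Hopf algebras over $k$, regarded as the category of abelian group objects in the category $\mathrm{Coalg}_k$ of cocommutative $k$-coalgebras (where the categorical product is $\otimes_k$). $\mathrm{AbSch}_k$ is the category of affine groups, i.e. abelian group objects in the category of affine $k$-schemes; it is anti-equivalent to $\mathrm{Hopf}_k$, but its tensor product is taken with respect to $\mathcal C=$ affine $k$-schemes. No finiteness assumptions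 are made. *)

(* Defs.v *)
From HB Require Import structures.
From mathcomp Require Import all_boot all_algebra separable.
From mathcomp Require Import boolp.

Set Implicit Arguments.
Unset Strict Implicit.
Unset Printing Implicit Defensive.

Import GRing.Theory.
Local Open Scope ring_scope.
Local Open Scope quotient_scope.

Record category := Category {
  obj :> Type;
  hom : obj -> obj -> Type;
  idc : forall X, hom X X;
  compc : forall X Y Z, hom Y Z -> hom X Y -> hom X Z;
  compcA : forall X Y Z T (h : hom Z T) (g : hom Y Z) (f : hom X Y),
    compc h (compc g f) = compc (compc h g) f;
  comp1c : forall X Y (f : hom X Y), compc (idc Y) f = f;
  compc1 : forall X Y (f : hom X Y), compc f (idc X) = f }.

Arguments idc {c} X.
Notation "g \oc f" := (compc g f) (at level 50, left associativity).

(* A category with chosen finite products (terminal object, binary products). *)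
Record fpCategory := FpCategory {
  fp_cat :> category;
  term : fp_cat;
  bang : forall X : fp_cat, hom X term;
  bang_uniq : forall X (f : hom X term), f = bang X;
  prodc : fp_cat -> fp_cat -> fp_cat;
  pr1 : forall X Y, hom (prodc X Y) X;
  pr2 : forall X Y, hom (prodc X Y) Y;
  pairc : forall T X Y, hom T X -> hom T Y -> hom T (prodc X Y);
  pr1_pair : forall T X Y (f : hom T X) (g : hom T Y),
    pr1 X Y \oc pairc f g = f;
  pr2_pair : forall T X Y (f : hom T X) (g : hom T Y),
    pr2 X Y \oc pairc f g = g;
  pair_uniq : forall T X Y (h : hom T (prodc X Y)),
    pairc (pr1 X Y \oc h) (pr2 X Y \oc h) = h }.

Arguments bang {_} X.
Arguments pr1 {_ X Y}.
Arguments pr2 {_ X Y}.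

Section FiniteProducts.
Variable C : fpCategory.

Definition prodmap (X Y X' Y' : C) (f : hom X X') (g : hom Y Y') :
  hom (prodc X Y) (prodc X' Y') := pairc (f \oc pr1) (g \oc pr2).

Definition prodassoc (X Y Z : C) :
  hom (prodc (prodc X Y) Z) (prodc X (prodc Y Z)) :=
  pairc (pr1 \oc pr1) (pairc (pr2 \oc pr1) pr2).

Definition prodswap (X Y : C) : hom (prodc X Y) (prodc Y X) := pairc pr2 pr1.

Lemma pair_comp (S T X Y : C) (f : hom T X) (g : hom T Y) (h : hom S T) :
  pairc f g \oc h = pairc (f \oc h) (g \oc h).
Proof. by rewrite -[LHS]pair_uniq !compcA pr1_pair pr2_pair. Qed.

Lemma prodmap_pair (T X Y X' Y' : C) (f : hom X X') (g : hom Y Y')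
    (x : hom T X) (y : hom T Y) :
  prodmap f g \oc pairc x y = pairc (f \oc x) (g \oc y).
Proof. by rewrite pair_comp -!compcA pr1_pair pr2_pair. Qed.

End FiniteProducts.

Arguments prodassoc {C}.
Arguments prodswap {C}.

Record abGroup (C : fpCategory) := AbGroup {
  ab_obj :> C;
  ab_add : hom (prodc ab_obj ab_obj) ab_obj;
  ab_zero : hom (term C) ab_obj;
  ab_opp : hom ab_obj ab_obj;
  ab_addA : ab_add \oc prodmap ab_add (idc ab_obj) =
            ab_add \oc prodmap (idc ab_obj) ab_add \oc prodassoc _ _ _;
  ab_addC : ab_add \oc prodswap _ _ = ab_add;
  ab_add0 : ab_add \oc pairc (ab_zero \oc bang ab_obj) (idc ab_obj) =
            idc ab_obj;
  ab_addN : ab_add \oc pairc ab_opp (idc ab_obj) =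
            ab_zero \oc bang ab_obj }.

Arguments ab_add {C} a.
Arguments ab_zero {C} a.
Arguments ab_opp {C} a.

Section AbelianGroupObjects.
Variable C : fpCategory.
Implicit Types A B : abGroup C.

Record abHom A B := AbHom {
  ab_hom :> hom (ab_obj A) (ab_obj B);
  ab_homD : ab_hom \oc ab_add A = ab_add B \oc prodmap ab_hom ab_hom }.

Lemma abHom_eq A B (f g : abHom A B) : ab_hom f = ab_hom g -> f = g.
Proof.
case: f g => [f fD] [g gD] /= fg; case: _ / fg in gD *.
by rewrite (Prop_irrelevance fD gD).
Qed.

Lemma abHom_idD A : idc A \oc ab_add A = ab_add A \oc prodmap (idc A) (idc A).
Proof.
rewrite comp1c /prodmap !comp1c.
by rewrite -[pr1]compc1 -[pr2]compc1 pair_uniq compc1.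
Qed.

Lemma abHom_compD A B D (g : abHom B D) (f : abHom A B) :
  (ab_hom g \oc ab_hom f) \oc ab_add A =
  ab_add D \oc prodmap (ab_hom g \oc ab_hom f) (ab_hom g \oc ab_hom f).
Proof.
rewrite -compcA ab_homD compcA ab_homD -compcA prodmap_pair.
by rewrite /prodmap !compcA.
Qed.

Definition abHom_id A : abHom A A := AbHom (abHom_idD A).
Definition abHom_comp A B D (g : abHom B D) (f : abHom A B) : abHom A D :=
  AbHom (abHom_compD g f).

Lemma abHom_compA A B D E (h : abHom D E) (g : abHom B D) (f : abHom A B) :
  abHom_comp h (abHom_comp g f) = abHom_comp (abHom_comp h g) f.
Proof. by apply: abHom_eq; apply: compcA. Qed.
Lemma abHom_comp1f A B (f : abHom A B) : abHom_comp (abHom_id B) f = f.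
Proof. by apply: abHom_eq; apply: comp1c. Qed.
Lemma abHom_compf1 A B (f : abHom A B) : abHom_comp f (abHom_id A) = f.
Proof. by apply: abHom_eq; apply: compc1. Qed.

Definition Ab : category :=
  @Category (abGroup C) abHom abHom_id abHom_comp abHom_compA abHom_comp1f
    abHom_compf1.

(* The sum of Hom(T, A) induced by the group structure of A. *)
Definition gadd A (T : C) (x y : hom T (ab_obj A)) : hom T (ab_obj A) :=
  ab_add A \oc pairc x y.

Lemma gadd_comp A (S T : C) (x y : hom T (ab_obj A)) (h : hom S T) :
  gadd x y \oc h = gadd (x \oc h) (y \oc h).
Proof. by rewrite /gadd -compcA pair_comp. Qed.

Lemma abHom_gadd A B (f : abHom A B) (T : C) (x y : hom T (ab_obj A)) :
  ab_hom f \oc gadd x y = gadd (ab_hom f \oc x) (ab_hom f \oc y).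
Proof. by rewrite /gadd compcA ab_homD -compcA prodmap_pair. Qed.

Definition bilinear_hom A A' B
    (b : hom (prodc (ab_obj A) (ab_obj A')) (ab_obj B)) : Prop :=
  forall T : C,
    (forall (x1 x2 : hom T (ab_obj A)) (y : hom T (ab_obj A')),
       b \oc pairc (gadd x1 x2) y = gadd (b \oc pairc x1 y) (b \oc pairc x2 y))
    /\
    (forall (x : hom T (ab_obj A)) (y1 y2 : hom T (ab_obj A')),
       b \oc pairc x (gadd y1 y2) = gadd (b \oc pairc x y1) (b \oc pairc x y2)).

Record Bil A A' B := MkBil {
  bil_hom :> hom (prodc (ab_obj A) (ab_obj A')) (ab_obj B);
  bil_homP : bilinear_hom bil_hom }.

Lemma Bil_eq A A' B (a b : Bil A A' B) : bil_hom a = bil_hom b -> a = b.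
Proof.
case: a b => [a aP] [b bP] /= ab; case: _ / ab in bP *.
by rewrite (Prop_irrelevance aP bP).
Qed.

Lemma bil_compP A A' B D (f : abHom B D) (b : Bil A A' B) :
  bilinear_hom (ab_hom f \oc bil_hom b).
Proof.
move=> T; have [bl br] := bil_homP b T.
by split=> *; rewrite -!compcA (bl, br) abHom_gadd.
Qed.

Definition bil_comp A A' B D (f : abHom B D) (b : Bil A A' B) : Bil A A' D :=
  MkBil (bil_compP f b).

Lemma bil_comp_natural A A' B D E
    (g : hom (c := Ab) D E) (f : hom (c := Ab) B D) (b : Bil A A' B) :
  bil_comp (g \oc f) b = bil_comp g (bil_comp f b).
Proof. by apply: Bil_eq; rewrite /= compcA. Qed.

(* The bijections f |-> f \o a are natural in B, see bil_comp_natural. *)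
Definition is_tensor_product A A' (T : Ab) (a : Bil A A' T) : Prop :=
  forall B : Ab, bijective (fun f : hom T B => bil_comp f a).

End AbelianGroupObjects.

Section LinearMaps.
Variables (k : fieldType) (V W : lmodType k).

Lemma linear_eq (f g : {linear V -> W}) : f =1 g -> f = g.
Proof.
case: f g => [f [[fD] [fZ]]] [g [[gD] [gZ]]] /= /funext fg.
case: _ / fg in gD gZ *.
by rewrite (Prop_irrelevance fD gD) (Prop_irrelevance fZ gZ).
Qed.

End LinearMaps.

Section TensorModule.
Variables (k : fieldType) (V W : lmodType k).

Definition tens_eval (U : lmodType k) (f : V -> W -> U) (s : seq (V * W)) : U :=
  \sum_(p <- s) f p.1 p.2.

(* A sequence [:: (v1, w1); ...; (vn, wn)] stands for the sum of the vi (x) wi;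
   two such formal sums are identified when every bilinear map takes the same
   value on them.  The universal property is given by tlift, tliftE and
   tensor_ext below. *)
Definition tens_eqv (s t : seq (V * W)) : bool :=
  `[< forall (U : lmodType k) (f : V -> W -> U),
        bilinear_for *:%R *:%R f -> tens_eval f s = tens_eval f t >].

Lemma tens_eqv_refl : reflexive tens_eqv.
Proof. by move=> s; apply/asboolP. Qed.

Lemma tens_eqv_sym : symmetric tens_eqv.
Proof.
by move=> s t; apply/asboolP/asboolP => st U f fB; rewrite (st U f fB).
Qed.

Lemma tens_eqv_trans : transitive tens_eqv.
Proof.
move=> t s u /asboolP st /asboolP tu; apply/asboolP => U f fB.
by rewrite (st U f fB) (tu U f fB).
Qed.

Canonical tens_equiv := EquivRel tens_eqv tens_eqv_refl tens_eqv_sym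
  tens_eqv_trans.

Definition tensor : Type := {eq_quot tens_eqv}.
HB.instance Definition _ := Choice.on tensor.
HB.instance Definition _ := EqQuotient.on tensor.

Definition tclass (s : seq (V * W)) : tensor := \pi_tensor s.

Lemma tclass_eq (s t : seq (V * W)) :
  (forall (U : lmodType k) (f : V -> W -> U),
     bilinear_for *:%R *:%R f -> tens_eval f s = tens_eval f t) ->
  tclass s = tclass t.
Proof. by move=> st; apply/eqmodP/asboolP. Qed.

Lemma tens_eval_repr (U : lmodType k) (f : V -> W -> U) (s : seq (V * W)) :
  bilinear_for *:%R *:%R f -> tens_eval f (repr (tclass s)) = tens_eval f s.
Proof.
move=> fB; have /eqmodP/asboolP : repr (tclass s) = s %[mod tensor].
  by rewrite reprK.
exact.
Qed.

Lemma tens_evalD (U : lmodType k) (f : V -> W -> U) (s t : seq (V * W)) :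
  tens_eval f (s ++ t) = tens_eval f s + tens_eval f t.
Proof. by rewrite /tens_eval big_cat. Qed.

Definition tscale_seq (a : k) (s : seq (V * W)) : seq (V * W) :=
  [seq (a *: p.1, p.2) | p <- s].

Lemma tens_evalZ (U : lmodType k) (f : V -> W -> U) a (s : seq (V * W)) :
  bilinear_for *:%R *:%R f ->
  tens_eval f (tscale_seq a s) = a *: tens_eval f s.
Proof.
case=> fl _; rewrite /tens_eval /tscale_seq big_map scaler_sumr.
apply: eq_bigr => p _ /=.
by have /= -> := GRing.scalable_linear (fl p.2).
Qed.

Definition tzero : tensor := tclass [::].
Definition tadd (x y : tensor) : tensor := tclass (repr x ++ repr y).
Definition tscale (a : k) (x : tensor) : tensor :=
  tclass (tscale_seq a (repr x)).
Definition topp (x : tensor) : tensor := tscale (- 1) x.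

Let evalE := (tens_eval_repr, tens_evalD, tens_evalZ).

Lemma taddA : associative tadd.
Proof. by move=> x y z; apply: tclass_eq => U f fB; rewrite !evalE // addrA. Qed.
Lemma taddC : commutative tadd.
Proof. by move=> x y; apply: tclass_eq => U f fB; rewrite !evalE // addrC. Qed.
Lemma tadd0 : left_id tzero tadd.
Proof.
move=> x; rewrite -[RHS]reprK; apply: tclass_eq => U f fB.
by rewrite !evalE // /tens_eval big_nil add0r.
Qed.
Lemma taddN : left_inverse tzero topp tadd.
Proof.
move=> x; apply: tclass_eq => U f fB.
by rewrite !evalE // scaleN1r addNr /tens_eval big_nil.
Qed.

HB.instance Definition _ := GRing.isZmodule.Build tensor taddA taddC tadd0 taddN.

Lemma tscaleA (a b : k) (x : tensor) : tscale a (tscale b x) = tscale (a * b) x.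
Proof. by apply: tclass_eq => U f fB; rewrite !evalE // scalerA. Qed.
Lemma tscale1 : left_id 1 tscale.
Proof.
move=> x; rewrite -[RHS]reprK; apply: tclass_eq => U f fB.
by rewrite !evalE // scale1r.
Qed.
Lemma tscaleDr : right_distributive tscale +%R.
Proof.
by move=> a x y; apply: tclass_eq => U f fB; rewrite !evalE // scalerDr.
Qed.
Lemma tscaleDl (x : tensor) : {morph tscale^~ x : a b / a + b}.
Proof.
by move=> a b; apply: tclass_eq => U f fB; rewrite !evalE // scalerDl.
Qed.

HB.instance Definition _ := GRing.Zmodule_isLmodule.Build k tensor
  tscaleA tscale1 tscaleDr tscaleDl.

Definition tens (v : V) (w : W) : tensor := tclass [:: (v, w)].

Lemma tens_bilinear : bilinear_for *:%R *:%R tens.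
Proof.
split=> [w a v v'|v a w w']; apply: tclass_eq => U f fB;
  rewrite !evalE // /tens_eval !big_seq1 /=.
- by have := fB.1 w a v v'.
- by have := fB.2 v a w w'.
Qed.

Lemma tensor_ind (P : tensor -> Prop) :
  (forall v w, P (tens v w)) -> (forall x y, P x -> P y -> P (x + y)) ->
  forall x, P x.
Proof.
move=> Pt PD x; rewrite -[x]reprK -/(tclass _).
elim: (repr x) => [|[v w] s IHs].
  rewrite (_ : tclass _ = tens 0 0) //; apply: tclass_eq => U f fB.
  rewrite /tens_eval big_nil big_seq1 /=.
  by have := fB.1 0 (- 1) 0 0; rewrite /= scaler0 addr0 scaleN1r addNr.
rewrite (_ : tclass _ = tens v w + tclass s); first exact: PD.
by apply: tclass_eq => U f fB; rewrite !evalE // /tens_eval big_cons big_seq1.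
Qed.

Lemma tensor_ext (U : lmodType k) (f g : {linear tensor -> U}) :
  (forall v w, f (tens v w) = g (tens v w)) -> f =1 g.
Proof. by move=> fg; elim/tensor_ind => // x y; rewrite !linearD => -> ->. Qed.

Section Lift.
Variables (U : lmodType k) (f : V -> W -> U) (fB : bilinear_for *:%R *:%R f).

(* The dummy let makes tlift depend on fB, so that it is canonically linear. *)
Definition tlift (x : tensor) : U := let _ := fB in tens_eval f (repr x).

Lemma tlift_linear : linear tlift.
Proof. by move=> a x y; rewrite /tlift !evalE. Qed.
HB.instance Definition _ :=
  GRing.isLinear.Build k tensor U *:%R tlift tlift_linear.

Lemma tliftE v w : tlift (tens v w) = f v w.
Proof. by rewrite /tlift evalE // /tens_eval big_seq1. Qed.

End Lift.

End TensorModule.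

Arguments tens {k V W}.
Notation "V \tens W" := (tensor V W) (at level 40, left associativity).
Notation "v *t w" := (tens v w) (at level 40, left associativity).

Section TensorMaps.
Variable k : fieldType.
Implicit Types U V W : lmodType k.

Lemma tensDl V W (v v' : V) (w : W) : (v + v') *t w = v *t w + v' *t w.
Proof. by have := (@tens_bilinear k V W).1 w 1 v v'; rewrite /= !scale1r. Qed.
Lemma tensDr V W (v : V) (w w' : W) : v *t (w + w') = v *t w + v *t w'.
Proof. by have := (@tens_bilinear k V W).2 v 1 w w'; rewrite /= !scale1r. Qed.
Lemma tensZl V W a (v : V) (w : W) : (a *: v) *t w = a *: (v *t w).
Proof. exact: (GRing.scalable_linear ((@tens_bilinear k V W).1 w)). Qed.
Lemma tensZr V W a (v : V) (w : W) : v *t (a *: w) = a *: (v *t w).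
Proof. exact: (GRing.scalable_linear ((@tens_bilinear k V W).2 v)). Qed.

Definition tensE := (tensDl, tensDr, tensZl, tensZr).

Lemma tmap_bilinear V V' W W' (f : {linear V -> V'}) (g : {linear W -> W'}) :
  bilinear_for *:%R *:%R (fun v w => f v *t g w).
Proof. by split=> ? ? ? ?; rewrite linearP !tensE. Qed.
Definition tmap V V' W W' (f : {linear V -> V'}) (g : {linear W -> W'}) : V \tens W -> V' \tens W' :=
  tlift (tmap_bilinear f g).
HB.instance Definition _ V V' W W' (f : {linear V -> V'}) (g : {linear W -> W'}) :=
  GRing.Linear.copy (tmap f g) (tlift (tmap_bilinear f g)).

Lemma tswap_bilinear V W : bilinear_for *:%R *:%R (fun (v : V) (w : W) => w *t v).
Proof. by split=> ? ? ? ?; rewrite !tensE. Qed.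
Definition tswap V W : V \tens W -> W \tens V :=
  tlift (@tswap_bilinear V W).
HB.instance Definition _ V W :=
  GRing.Linear.copy (@tswap V W) (tlift (@tswap_bilinear V W)).

Lemma tunit_bilinear V :
  bilinear_for *:%R *:%R (fun (a : k^o) (v : V) => a *: v).
Proof.
split=> [v a b c|b a v v'] /=; first by rewrite scalerDl scalerA.
by rewrite scalerDr !scalerA mulrC.
Qed.
Definition tunit V : k^o \tens V -> V :=
  tlift (@tunit_bilinear V).
HB.instance Definition _ V :=
  GRing.Linear.copy (@tunit V) (tlift (@tunit_bilinear V)).

Lemma tassoc_bilinear1 U V W (w : W) :
  bilinear_for *:%R *:%R (fun (u : U) (v : V) => u *t (v *t w)).
Proof. by split=> ? ? ? ?; rewrite !tensE. Qed.
Lemma tassoc_bilinear U V W :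
  bilinear_for *:%R *:%R
    (fun (x : U \tens V) (w : W) => tlift (tassoc_bilinear1 U V w) x).
Proof.
split=> [w a x y|x a w w'] /=; first exact: linearP.
elim/tensor_ind: x => [u v|x y]; first by rewrite !tliftE !tensE.
by move=> IHx IHy; rewrite !linearD /= IHx IHy addrACA.
Qed.
Definition tassoc U V W : (U \tens V) \tens W -> U \tens (V \tens W) :=
  tlift (@tassoc_bilinear U V W).
HB.instance Definition _ U V W :=
  GRing.Linear.copy (@tassoc U V W) (tlift (@tassoc_bilinear U V W)).

Lemma tassocV_bilinear1 U V W (u : U) :
  bilinear_for *:%R *:%R (fun (v : V) (w : W) => (u *t v) *t w).
Proof. by split=> ? ? ? ?; rewrite !tensE. Qed.
Lemma tassocV_bilinear U V W :
  bilinear_for *:%R *:%R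
    (fun (u : U) (x : V \tens W) => tlift (tassocV_bilinear1 V W u) x).
Proof.
split=> [x a u u'|u a x y] /=; last exact: linearP.
elim/tensor_ind: x => [v w|x y]; first by rewrite !tliftE !tensE.
by move=> IHx IHy; rewrite !linearD /= IHx IHy addrACA.
Qed.
Definition tassocV U V W : U \tens (V \tens W) -> (U \tens V) \tens W :=
  tlift (@tassocV_bilinear U V W).
HB.instance Definition _ U V W :=
  GRing.Linear.copy (@tassocV U V W) (tlift (@tassocV_bilinear U V W)).

Lemma tmapE V V' W W' (f : {linear V -> V'}) (g : {linear W -> W'}) v w :
  tmap f g (v *t w) = f v *t g w.
Proof. exact: tliftE. Qed.
Lemma tswapE V W (v : V) (w : W) : tswap (v *t w) = w *t v.
Proof. exact: tliftE. Qed.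
Lemma tunitE V (a : k^o) (v : V) : tunit (a *t v) = a *: v.
Proof. exact: tliftE. Qed.
Lemma tassocE U V W (u : U) (v : V) (w : W) :
  tassoc (u *t v *t w) = u *t (v *t w).
Proof. by rewrite /tassoc !tliftE. Qed.
Lemma tassocVE U V W (u : U) (v : V) (w : W) :
  tassocV (u *t (v *t w)) = u *t v *t w.
Proof. by rewrite /tassocV !tliftE. Qed.

(* The interchange (u (x) v) (x) (u' (x) v') |-> (u (x) u') (x) (v (x) v'). *)
Definition tmid U V U' V' :
  (U \tens V) \tens (U' \tens V') -> (U \tens U') \tens (V \tens V') :=
  @tassocV U U' (V \tens V')
  \o tmap (V := U) idfun
       (@tassoc U' V V' \o tmap (@tswap V U') (W := V') idfun \o @tassocV V U' V')
  \o @tassoc U V (U' \tens V').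
HB.instance Definition _ U V U' V' := GRing.Linear.copy (@tmid U V U' V')
  (@tassocV U U' (V \tens V')
  \o tmap (V := U) idfun
       (@tassoc U' V V' \o tmap (@tswap V U') (W := V') idfun \o @tassocV V U' V')
  \o @tassoc U V (U' \tens V')).

Lemma tmidE U V U' V' (u : U) (v : V) (u' : U') (v' : V') :
  tmid ((u *t v) *t (u' *t v')) = (u *t u') *t (v *t v').
Proof.
by rewrite /tmid /= tassocE tmapE /= tassocVE tmapE /= tswapE tassocE tassocVE.
Qed.

Lemma tmap_comp V V' V'' W W' W'' (f' : {linear V' -> V''})
    (g' : {linear W' -> W''}) (f : {linear V -> V'}) (g : {linear W -> W'}) t :
  tmap f' g' (tmap f g t) = tmap (f' \o f) (g' \o g) t.
Proof.
elim/tensor_ind: t => [v w|x y]; first by rewrite !tmapE.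
by move=> IHx IHy; rewrite !linearD /= IHx IHy.
Qed.

Lemma tmap_eq V V' W W' (f f' : {linear V -> V'}) (g g' : {linear W -> W'}) :
  f =1 f' -> g =1 g' -> tmap f g =1 tmap f' g'.
Proof. by move=> /linear_eq-> /linear_eq->. Qed.

Lemma tmap_id V W (t : V \tens W) : tmap (V := V) (W := W) idfun idfun t = t.
Proof.
elim/tensor_ind: t => [v w|x y]; first by rewrite tmapE.
by move=> IHx IHy; rewrite linearD /= IHx IHy.
Qed.

Lemma tassocK U V W (t : (U \tens V) \tens W) : tassocV (tassoc t) = t.
Proof.
elim/tensor_ind: t => [x w|x y]; last by rewrite !linearD /= => -> ->.
elim/tensor_ind: x => [u v|x y]; first by rewrite tassocE tassocVE.
by rewrite !(tensE, linearD) /= => -> ->.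
Qed.

Lemma tassocVK U V W (t : U \tens (V \tens W)) : tassoc (tassocV t) = t.
Proof.
elim/tensor_ind: t => [u x|x y]; last by rewrite !linearD /= => -> ->.
elim/tensor_ind: x => [v w|x y]; first by rewrite tassocVE tassocE.
by rewrite !(tensE, linearD) /= => -> ->.
Qed.

(* Equality of linear maps on a tensor of tensors, tested on pure tensors. *)
Lemma tensor_ext22 U V U' V' (T : lmodType k)
    (f g : {linear (U \tens V) \tens (U' \tens V') -> T}) :
  (forall u v u' v', f ((u *t v) *t (u' *t v')) = g ((u *t v) *t (u' *t v'))) ->
  f =1 g.
Proof.
move=> fg; apply: tensor_ext => x y.
elim/tensor_ind: x => [u v|x x']; last by rewrite !tensE !linearD => -> ->.
elim/tensor_ind: y => [u' v'|y y']; first exact: fg.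
by rewrite !tensE !linearD => -> ->.
Qed.

End TensorMaps.

Section Coalgebras.
Variable k : fieldType.

Record coalg := Coalg {
  coalg_mod :> lmodType k;
  comul : {linear coalg_mod -> coalg_mod \tens coalg_mod};
  counit : {linear coalg_mod -> k^o};
  comulA : forall c, tassoc (tmap comul (W := coalg_mod) idfun (comul c)) =
                     tmap (V := coalg_mod) idfun comul (comul c);
  comulC : forall c, tswap (comul c) = comul c;
  counitl : forall c, tunit (tmap counit (W := coalg_mod) idfun (comul c)) = c }.

Record coalgHom (C D : coalg) := CoalgHom {
  coalg_fun :> {linear C -> D};
  coalg_comul : forall c,
    @comul D (coalg_fun c) = tmap coalg_fun coalg_fun (@comul C c);
  coalg_counit : forall c, @counit D (coalg_fun c) = @counit C c }.

Arguments comul : clear implicits.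
Arguments counit : clear implicits.

Lemma coalgHom_eq (C D : coalg) (f g : coalgHom C D) : f =1 g -> f = g.
Proof.
case: f g => [f fD fe] [g gD ge] /= /linear_eq fg; case: _ / fg in gD ge *.
by rewrite (Prop_irrelevance fD gD) (Prop_irrelevance fe ge).
Qed.

Section Id.
Variable C : coalg.
Lemma coalg_id_comul (c : C) :
  comul C c = tmap (V := C) (W := C) idfun idfun (comul C c).
Proof. by rewrite tmap_id. Qed.
Definition coalg_id : coalgHom C C :=
  @CoalgHom C C idfun coalg_id_comul (fun c => erefl).
End Id.

Section Comp.
Variables (C D E : coalg) (g : coalgHom D E) (f : coalgHom C D).
Lemma coalg_comp_comul c :
  comul E ((g \o f) c) = tmap (g \o f) (g \o f) (comul C c).
Proof. by rewrite /= !coalg_comul tmap_comp. Qed.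
Lemma coalg_comp_counit c : counit E ((g \o f) c) = counit C c.
Proof. by rewrite /= !coalg_counit. Qed.
Definition coalg_comp : coalgHom C E :=
  @CoalgHom C E (g \o f) coalg_comp_comul coalg_comp_counit.
End Comp.

Lemma coalg_compA (C D E F : coalg) (h : coalgHom E F) (g : coalgHom D E)
    (f : coalgHom C D) :
  coalg_comp h (coalg_comp g f) = coalg_comp (coalg_comp h g) f.
Proof. exact: coalgHom_eq. Qed.
Lemma coalg_comp1f (C D : coalg) (f : coalgHom C D) :
  coalg_comp (coalg_id D) f = f.
Proof. exact: coalgHom_eq. Qed.
Lemma coalg_compf1 (C D : coalg) (f : coalgHom C D) :
  coalg_comp f (coalg_id C) = f.
Proof. exact: coalgHom_eq. Qed.

Definition coalg_cat : category :=
  @Category coalg coalgHom coalg_id coalg_comp coalg_compA coalg_comp1f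
    coalg_compf1.

Section Terminal.

Definition kcomul (a : k^o) : k^o \tens k^o := (a : k) *: ((1 : k^o) *t (1 : k^o)).
Lemma kcomul_linear : linear kcomul.
Proof. by move=> a b c; rewrite /kcomul scalerDl scalerA. Qed.
HB.instance Definition _ :=
  GRing.isLinear.Build k k^o (k^o \tens k^o) *:%R kcomul kcomul_linear.

Lemma kcomulE (a b : k^o) : a *t b = (a * b : k) *: ((1 : k^o) *t (1 : k^o)).
Proof.
rewrite -[a in LHS]mulr1 -[b in LHS]mulr1.
by rewrite -[a * 1]/(a *: (1 : k^o)) -[b * 1]/(b *: (1 : k^o)) !tensE scalerA.
Qed.

Lemma kcomulA c : tassoc (tmap kcomul (W := k^o) idfun (kcomul c)) =
                  tmap (V := k^o) idfun kcomul (kcomul c).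
Proof. by rewrite !linearZ /= !tmapE /kcomul !tensE !linearZ /= tassocE. Qed.
Lemma kcomulC c : tswap (kcomul c) = kcomul c.
Proof. by rewrite linearZ /= tswapE. Qed.
Lemma kcounitl c :
  tunit (tmap (V := k^o) idfun (W := k^o) idfun (kcomul c)) = c.
Proof. by rewrite tmap_id linearZ /= tunitE scale1r -[LHS]/(c * 1) mulr1. Qed.

Definition coalg_term : coalg := @Coalg k^o kcomul idfun kcomulA kcomulC kcounitl.

Lemma counit_comul (C : coalg) (c : C) :
  kcomul (counit C c) = tmap (counit C) (counit C) (comul C c).
Proof.
rewrite -{1}[c]counitl; elim/tensor_ind: (comul C c) => [x y|x y].
  by rewrite !tmapE tunitE linearZ /= kcomulE.
by rewrite !linearD /= => -> ->.
Qed.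

Definition coalg_bang (C : coalg) : coalgHom C coalg_term :=
  @CoalgHom C coalg_term (counit C) (@counit_comul C) (fun c => erefl).

Lemma coalg_bang_uniq (C : coalg) (f : coalgHom C coalg_term) : f = coalg_bang C.
Proof. by apply: coalgHom_eq => c; exact: (coalg_counit f c). Qed.

End Terminal.

Lemma counitr (C : coalg) (c : C) :
  tunit (tmap (counit C) (W := C) idfun (tswap (comul C c))) = c.
Proof. by rewrite comulC counitl. Qed.

Section Product.
Variables C D : coalg.

Definition pcomul (x : C \tens D) : (C \tens D) \tens (C \tens D) :=
  tmid (tmap (comul C) (comul D) x).
HB.instance Definition _ := GRing.Linear.copy pcomul
  (@tmid k C C D D \o tmap (comul C) (comul D)).

Definition pcounit (x : C \tens D) : k^o :=
  tunit (tmap (counit C) (counit D) x).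
HB.instance Definition _ := GRing.Linear.copy pcounit
  (@tunit k k^o \o tmap (counit C) (counit D)).

Lemma pcomulE c d : pcomul (c *t d) = tmid (comul C c *t comul D d).
Proof. by rewrite /pcomul tmapE. Qed.

Lemma pcounitE c d : pcounit (c *t d) = counit C c * counit D d.
Proof. by rewrite /pcounit tmapE tunitE. Qed.

Let mid3 (x : (C \tens (C \tens C)) \tens (D \tens (D \tens D))) :=
  tmap (V := C \tens D) idfun (@tmid k C C D D) (tmid x).
HB.instance Definition _ := GRing.Linear.copy mid3
  (tmap (V := C \tens D) idfun (@tmid k C C D D) \o @tmid _ _ _ _ _).

Let mid3E (c : C) (x : C \tens C) (d : D) (y : D \tens D) :
  mid3 ((c *t x) *t (d *t y)) = (c *t d) *t tmid (x *t y).
Proof. by rewrite /mid3 tmidE tmapE. Qed.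

Let mid3_assoc (x : C \tens C) c (y : D \tens D) d :
  tassoc (tmid (x *t y) *t (c *t d)) = mid3 (tassoc (x *t c) *t tassoc (y *t d)).
Proof.
elim/tensor_ind: x => [c1 c2|x x']; last first.
  by rewrite !(tensE, linearD) /= => -> ->.
elim/tensor_ind: y => [d1 d2|y y']; last first.
  by rewrite !(tensE, linearD) /= => -> ->.
by rewrite tmidE !tassocE mid3E tmidE.
Qed.

Lemma pcomulA x : tassoc (tmap pcomul (W := C \tens D) idfun (pcomul x)) =
                  tmap (V := C \tens D) idfun pcomul (pcomul x).
Proof.
have L t s : tassoc (tmap pcomul (W := C \tens D) idfun (tmid (t *t s))) =
    mid3 (tassoc (tmap (comul C) (W := C) idfun t) *t
          tassoc (tmap (comul D) (W := D) idfun s)).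
  elim/tensor_ind: t => [c c'|t t']; last first.
    by rewrite !(tensE, linearD) /= => -> ->.
  elim/tensor_ind: s => [d d'|s s']; last first.
    by rewrite !(tensE, linearD) /= => -> ->.
  by rewrite tmidE !tmapE /= pcomulE mid3_assoc.
have R t s : tmap (V := C \tens D) idfun pcomul (tmid (t *t s)) =
    mid3 (tmap (V := C) idfun (comul C) t *t tmap (V := D) idfun (comul D) s).
  elim/tensor_ind: t => [c c'|t t']; last first.
    by rewrite !(tensE, linearD) /= => -> ->.
  elim/tensor_ind: s => [d d'|s s']; last first.
    by rewrite !(tensE, linearD) /= => -> ->.
  by rewrite tmidE !tmapE /= pcomulE mid3E.
elim/tensor_ind: x => [c d|x y]; last by rewrite !linearD /= => -> ->.
by rewrite pcomulE L R !comulA.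
Qed.

Lemma pcomulC x : tswap (pcomul x) = pcomul x.
Proof.
have L t s : tswap (@tmid k C C D D (t *t s)) = tmid (tswap t *t tswap s).
  elim/tensor_ind: t => [c c'|t t']; last first.
    by rewrite !(tensE, linearD) /= => -> ->.
  elim/tensor_ind: s => [d d'|s s']; last first.
    by rewrite !(tensE, linearD) /= => -> ->.
  by rewrite !(tmidE, tswapE).
elim/tensor_ind: x => [c d|x y]; last by rewrite !linearD /= => -> ->.
by rewrite pcomulE L !comulC.
Qed.

Lemma pcounitl x :
  tunit (tmap pcounit (W := C \tens D) idfun (pcomul x)) = x.
Proof.
have L t s : tunit (tmap pcounit (W := C \tens D) idfun (tmid (t *t s))) =
    tunit (tmap (counit C) (W := C) idfun t) *t
    tunit (tmap (counit D) (W := D) idfun s).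
  elim/tensor_ind: t => [c c'|t t']; last first.
    by rewrite !(tensE, linearD) /= => -> ->.
  elim/tensor_ind: s => [d d'|s s']; last first.
    by rewrite !(tensE, linearD) /= => -> ->.
  by rewrite tmidE !tmapE !tunitE /= pcounitE !tensE scalerA.
elim/tensor_ind: x => [c d|x y]; last by rewrite !linearD /= => -> ->.
by rewrite pcomulE L !counitl.
Qed.

Definition coalg_prod : coalg :=
  @Coalg (C \tens D) pcomul pcounit pcomulA pcomulC pcounitl.

Definition cpr1 (x : C \tens D) : C :=
  tunit (tmap (counit D) (W := C) idfun (tswap x)).
HB.instance Definition _ := GRing.Linear.copy cpr1
  (@tunit k C \o (tmap (counit D) (W := C) idfun \o @tswap k C D)).

Definition cpr2 (x : C \tens D) : D :=
  tunit (tmap (counit C) (W := D) idfun x).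
HB.instance Definition _ := GRing.Linear.copy cpr2
  (@tunit k D \o tmap (counit C) (W := D) idfun).

Lemma cpr1E c d : cpr1 (c *t d) = counit D d *: c.
Proof. by rewrite /cpr1 tswapE tmapE tunitE. Qed.
Lemma cpr2E c d : cpr2 (c *t d) = counit C c *: d.
Proof. by rewrite /cpr2 tmapE tunitE. Qed.

Lemma tunit_counit (E : coalg) (e : E) :
  tunit (tmap (counit E) (counit E) (comul E e)) = counit E e.
Proof.
by rewrite -counit_comul /kcomul linearZ /= tunitE scale1r -[LHS]/(_ * 1) mulr1.
Qed.

Lemma cpr1_comul x : comul C (cpr1 x) = tmap cpr1 cpr1 (comul coalg_prod x).
Proof.
have L t s : tmap cpr1 cpr1 (tmid (t *t s)) =
    tunit (tmap (counit D) (counit D) s) *: t.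
  elim/tensor_ind: t => [c c'|t t']; last first.
    by rewrite !(tensE, linearD, scalerDr) /= => -> ->.
  elim/tensor_ind: s => [d d'|s s']; last first.
    by rewrite !(tensE, linearD, scalerDl) /= => -> ->.
  by rewrite tmidE !tmapE /= !cpr1E tunitE !tensE scalerA.
elim/tensor_ind: x => [c d|x y]; last by rewrite !linearD /= => -> ->.
by rewrite /= pcomulE L tunit_counit cpr1E linearZ.
Qed.

Lemma cpr2_comul x : comul D (cpr2 x) = tmap cpr2 cpr2 (comul coalg_prod x).
Proof.
have L t s : tmap cpr2 cpr2 (tmid (t *t s)) =
    tunit (tmap (counit C) (counit C) t) *: s.
  elim/tensor_ind: t => [c c'|t t']; last first.
    by rewrite !(tensE, linearD, scalerDl) /= => -> ->.
  elim/tensor_ind: s => [d d'|s s']; last first.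
    by rewrite !(tensE, linearD, scalerDr) /= => -> ->.
  by rewrite tmidE !tmapE /= !cpr2E tunitE !tensE scalerA.
elim/tensor_ind: x => [c d|x y]; last by rewrite !linearD /= => -> ->.
by rewrite /= pcomulE L tunit_counit cpr2E linearZ.
Qed.

Lemma cpr1_counit x : counit C (cpr1 x) = counit coalg_prod x.
Proof.
elim/tensor_ind: x => [c d|x y]; last by rewrite !linearD /= => -> ->.
by rewrite cpr1E linearZ /= pcounitE mulrC.
Qed.
Lemma cpr2_counit x : counit D (cpr2 x) = counit coalg_prod x.
Proof.
elim/tensor_ind: x => [c d|x y]; last by rewrite !linearD /= => -> ->.
by rewrite cpr2E linearZ /= pcounitE.
Qed.

Definition coalg_pr1 : coalgHom coalg_prod C :=
  @CoalgHom coalg_prod C cpr1 cpr1_comul cpr1_counit.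
Definition coalg_pr2 : coalgHom coalg_prod D :=
  @CoalgHom coalg_prod D cpr2 cpr2_comul cpr2_counit.

End Product.

(* For cocommutative C, the comultiplication is itself a coalgebra map. *)
Lemma tmid_comul (C : coalg) (x : C) :
  tmid (tmap (comul C) (comul C) (comul C x)) =
  tmap (comul C) (comul C) (comul C x).
Proof.
have E t : tassoc (tmap (comul C) (comul C) t) =
    tmap (V := C) idfun (tmap (V := C) idfun (comul C))
      (tassoc (tmap (comul C) (W := C) idfun t)).
  elim/tensor_ind: t => [c c'|t t']; last by rewrite !linearD /= => -> ->.
  rewrite !tmapE /=; elim/tensor_ind: (comul C c) => [c1 c2|y z].
    by rewrite !tassocE tmapE /= tmapE.
  by rewrite !tensE !linearD /= => -> ->.
have E4 : tassoc (tmap (comul C) (comul C) (comul C x)) =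
    tmap (V := C) idfun
      (@tassoc k C C C \o (tmap (comul C) (W := C) idfun \o comul C))
      (comul C x).
  rewrite E comulA tmap_comp; apply: tmap_eq => // y /=.
  by rewrite comulA.
rewrite -[RHS]tassocK /tmid /= E4; congr tassocV.
rewrite tmap_comp; apply: tmap_eq => // y /=; congr tassoc.
rewrite tassocK tmap_comp; apply: tmap_eq => // z /=.
by rewrite comulC.
Qed.

Section Pairing.
Variables (T C D : coalg) (f : coalgHom T C) (g : coalgHom T D).

Definition cpair (x : T) : coalg_prod C D := tmap f g (comul T x).
HB.instance Definition _ := GRing.Linear.copy cpair (tmap f g \o comul T).

Lemma cpair_comul x :
  comul (coalg_prod C D) (cpair x) = tmap cpair cpair (comul T x).
Proof.
rewrite /= /pcomul /cpair tmap_comp.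
rewrite (@tmap_eq k _ _ _ _ _ (tmap f f \o comul T) _ (tmap g g \o comul T)).
- rewrite -tmap_comp.
  have L t : tmid (tmap (tmap f f) (tmap g g) t) = tmap (tmap f g) (tmap f g) (tmid t).
    have := @tensor_ext22 k T T T T _ (@tmid k C C D D \o tmap (tmap f f) (tmap g g))
     (tmap (tmap f g) (tmap f g) \o @tmid k T T T T).
    by apply=> u v u' v' /=; rewrite tmapE /= !tmapE !tmidE tmapE /= !tmapE.
  rewrite L tmid_comul tmap_comp; exact: tmap_eq.
- by move=> c /=; rewrite coalg_comul.
- by move=> c /=; rewrite coalg_comul.
Qed.

Lemma cpair_counit x : counit (coalg_prod C D) (cpair x) = counit T x.
Proof.
rewrite /= /pcounit /cpair tmap_comp -[RHS]tunit_counit; congr tunit.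
by apply: tmap_eq => c /=; rewrite coalg_counit.
Qed.

Definition coalg_pair : coalgHom T (coalg_prod C D) :=
  @CoalgHom T (coalg_prod C D) cpair cpair_comul cpair_counit.

Lemma coalg_pr1_pair : coalg_comp (coalg_pr1 C D) coalg_pair = f.
Proof.
apply: coalgHom_eq => x /=; rewrite /cpair -[in RHS](counitr x).
elim/tensor_ind: (comul T x) => [y z|y z]; last by rewrite !linearD /= => -> ->.
by rewrite tmapE cpr1E tswapE tmapE tunitE linearZ /= coalg_counit.
Qed.

Lemma coalg_pr2_pair : coalg_comp (coalg_pr2 C D) coalg_pair = g.
Proof.
apply: coalgHom_eq => x /=; rewrite /cpair -[in RHS](counitl x).
elim/tensor_ind: (comul T x) => [y z|y z]; last by rewrite !linearD /= => -> ->.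
by rewrite tmapE cpr2E tmapE tunitE linearZ /= coalg_counit.
Qed.

End Pairing.

Lemma coalg_pair_uniq (T C D : coalg) (h : coalgHom T (coalg_prod C D)) :
  coalg_pair (coalg_comp (coalg_pr1 C D) h) (coalg_comp (coalg_pr2 C D) h) = h.
Proof.
apply: coalgHom_eq => x /=; rewrite /cpair /=.
rewrite -(tmap_comp (@cpr1 C D) (@cpr2 C D) h h) -[X in tmap _ _ X](coalg_comul h x) /=.
elim/tensor_ind: (h x) => [c d|y z]; last by rewrite !linearD /= => -> ->.
rewrite pcomulE -[in RHS](counitr c) -[in RHS](counitl d).
elim/tensor_ind: (comul C c) => [c1 c2|t t']; last first.
  by rewrite !(tensE, linearD) /= => -> ->.
elim/tensor_ind: (comul D d) => [d1 d2|s s']; last first.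
  by rewrite !(tensE, linearD) /= => -> ->.
rewrite tmidE !(tmapE, tswapE) /= cpr1E cpr2E !tunitE !tensE !scalerA.
by rewrite mulrC.
Qed.

(* The categorical product of cocommutative coalgebras is the tensor product. *)
Definition CoalgCat : fpCategory :=
  @FpCategory coalg_cat coalg_term coalg_bang coalg_bang_uniq coalg_prod
    coalg_pr1 coalg_pr2 coalg_pair coalg_pr1_pair coalg_pr2_pair coalg_pair_uniq.

End Coalgebras.

Section Algebras.
Variable k : fieldType.

(* Commutative k-algebras.  comPzRingType, unlike comAlgType, does not exclude
   the zero ring, i.e. the empty scheme. *)
Record calg := Calg {
  calg_ring :> comPzRingType;
  calg_in : {rmorphism k -> calg_ring} }.

Record calgHom (A B : calg) := CalgHom {
  calg_fun :> {rmorphism A -> B};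
  calg_funE : forall a, calg_fun (calg_in A a) = calg_in B a }.

Lemma calgHom_eq (A B : calg) (f g : calgHom A B) : f =1 g -> f = g.
Proof.
case: f g => [[f [[fD] [fM]]] fE] [[g [[gD] [gM]]] gE] /= /funext fg.
case: _ / fg in gD gM gE *.
rewrite (Prop_irrelevance fD gD) (Prop_irrelevance fM gM) in fE gE *.
by rewrite (Prop_irrelevance fE gE).
Qed.

Definition calg_id (A : calg) : calgHom A A :=
  @CalgHom A A idfun (fun a => erefl).

Section Comp.
Variables (A B C : calg) (g : calgHom B C) (f : calgHom A B).
Lemma calg_compE a : (g \o f) (calg_in A a) = calg_in C a.
Proof. by rewrite /= !calg_funE. Qed.
Definition calg_comp : calgHom A C := @CalgHom A C (g \o f) calg_compE.
End Comp.

(* The underlying k-module of a k-algebra. *)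
Definition calg_mod (A : calg) : Type := A.
HB.instance Definition _ A := GRing.Zmodule.on (calg_mod A).

Section Module.
Variable A : calg.
Let scale (a : k) (x : calg_mod A) : calg_mod A := calg_in A a * (x : A).
Let scaleA a b x : scale a (scale b x) = scale (a * b) x.
Proof. by rewrite /scale mulrA rmorphM. Qed.
Let scale1 : left_id 1 scale.
Proof. by move=> x; rewrite /scale rmorph1 mul1r. Qed.
Let scaleDr : right_distributive scale +%R.
Proof. by move=> a x y; rewrite /scale mulrDr. Qed.
Let scaleDl x : {morph scale^~ x : a b / a + b}.
Proof. by move=> a b; rewrite /scale rmorphD mulrDl. Qed.
HB.instance Definition _ := GRing.Zmodule_isLmodule.Build k (calg_mod A)
  scaleA scale1 scaleDr scaleDl.

Lemma calg_scaleE (a : k) (x : calg_mod A) : a *: x = calg_in A a * (x : A) :> A.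
Proof. by []. Qed.

Lemma calg_mult_bilinear :
  bilinear_for *:%R *:%R (fun x y : calg_mod A => (x : A) * (y : A) : calg_mod A).
Proof.
split=> [x a y z|x a y z] /=; rewrite !calg_scaleE.
  by rewrite mulrDl mulrA.
by rewrite mulrDr mulrCA.
Qed.
Definition calg_mult (x : calg_mod A \tens calg_mod A) : calg_mod A :=
  tlift calg_mult_bilinear x.
HB.instance Definition _ :=
  GRing.Linear.copy calg_mult (tlift calg_mult_bilinear).
Lemma calg_multE (x y : calg_mod A) : calg_mult (x *t y) = (x : A) * (y : A).
Proof. exact: tliftE. Qed.

End Module.

Section TensorAlgebra.
Variables A B : calg.

Definition talg : Type := calg_mod A \tens calg_mod B.
HB.instance Definition _ := GRing.Lmodule.on talg.

Definition tpure (a : A) (b : B) : talg := (a : calg_mod A) *t (b : calg_mod B).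

Definition tmul (x y : talg) : talg :=
  tmap (@calg_mult A) (@calg_mult B) (tmid (x *t y)).
Definition tone : talg := tpure 1 1.

Lemma tmulE a b a' b' :
  tmul (tpure a b) (tpure a' b') = tpure (a * a') (b * b').
Proof. by rewrite /tmul tmidE tmapE /= !calg_multE. Qed.

Lemma tmulDl : left_distributive tmul +%R.
Proof. by move=> x y z; rewrite /tmul tensDl !linearD. Qed.
Let tmulDr : right_distributive tmul +%R.
Proof. by move=> x y z; rewrite /tmul tensDr !linearD. Qed.

Lemma talg_ind (P : talg -> Prop) :
  (forall a b, P (tpure a b)) -> (forall x y, P x -> P y -> P (x + y)) ->
  forall x, P x.
Proof. exact: (@tensor_ind k (calg_mod A) (calg_mod B)). Qed.

Lemma tmulA : associative tmul.
Proof.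
elim/talg_ind=> [a b|x x' IH IH'] y z; last by rewrite !tmulDl IH IH'.
elim/talg_ind: y => [a' b'|y y' IH IH']; last first.
  by rewrite !(tmulDl, tmulDr) IH IH'.
elim/talg_ind: z => [a'' b''|z z' IH IH']; last by rewrite !tmulDr IH IH'.
by rewrite !tmulE !mulrA.
Qed.
Lemma tmulC : commutative tmul.
Proof.
elim/talg_ind=> [a b|x x' IH IH'] y; last by rewrite tmulDl tmulDr IH IH'.
elim/talg_ind: y => [a' b'|y y' IH IH']; last by rewrite tmulDl tmulDr IH IH'.
by rewrite !tmulE mulrC [b * b']mulrC.
Qed.
Lemma tmul1 : left_id tone tmul.
Proof.
elim/talg_ind=> [a b|x x' IH IH']; last by rewrite tmulDr IH IH'.
by rewrite tmulE !mul1r.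
Qed.

HB.instance Definition _ :=
  GRing.Zmodule_isComPzRing.Build talg tmulA tmulC tmul1 tmulDl.

Lemma talg_mulE a b a' b' :
  tpure a b * tpure a' b' = tpure (a * a') (b * b').
Proof. exact: tmulE. Qed.

Definition talg_inl (a : A) : talg := tpure a 1.
Lemma talg_inl_zmod : zmod_morphism talg_inl.
Proof.
move=> a a'; apply/eqP; rewrite eq_sym subr_eq; apply/eqP.
by rewrite /talg_inl /tpure -tensDl subrK.
Qed.
Lemma talg_inl_monoid : monoid_morphism talg_inl.
Proof. by split=> // a a'; rewrite /talg_inl talg_mulE mulr1. Qed.
HB.instance Definition _ := GRing.isZmodMorphism.Build A talg talg_inl
  talg_inl_zmod.
HB.instance Definition _ := GRing.isMonoidMorphism.Build A talg talg_inl
  talg_inl_monoid.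

Definition talg_inr (b : B) : talg := tpure 1 b.
Lemma talg_inr_zmod : zmod_morphism talg_inr.
Proof.
move=> b b'; apply/eqP; rewrite eq_sym subr_eq; apply/eqP.
by rewrite /talg_inr /tpure -tensDr subrK.
Qed.
Lemma talg_inr_monoid : monoid_morphism talg_inr.
Proof. by split=> // b b'; rewrite /talg_inr talg_mulE mulr1. Qed.
HB.instance Definition _ := GRing.isZmodMorphism.Build B talg talg_inr
  talg_inr_zmod.
HB.instance Definition _ := GRing.isMonoidMorphism.Build B talg talg_inr
  talg_inr_monoid.

Definition calg_tens : calg := @Calg talg (talg_inl \o calg_in A).

Definition calg_inl : calgHom A calg_tens :=
  @CalgHom A calg_tens talg_inl (fun a => erefl).

Lemma calg_inrE a : talg_inr (calg_in B a) = calg_in calg_tens a.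
Proof.
rewrite /= /talg_inr /talg_inl /tpure.
have := tensZl a (1 : calg_mod A) (1 : calg_mod B); rewrite -tensZr.
by rewrite /= !calg_scaleE !mulr1.
Qed.
Definition calg_inr : calgHom B calg_tens := @CalgHom B calg_tens talg_inr calg_inrE.

End TensorAlgebra.

Section Copair.
Variables (A B C : calg) (f : calgHom A C) (g : calgHom B C).

Lemma copair_bilinear : bilinear_for *:%R *:%R
  (fun (a : calg_mod A) (b : calg_mod B) => f a * g b : calg_mod C).
Proof.
split=> [b c a a'|a c b b'] /=; rewrite !calg_scaleE rmorphD rmorphM calg_funE.
  by rewrite mulrDl mulrA.
by rewrite mulrDr mulrCA.
Qed.
Definition copair (x : talg A B) : C := tlift copair_bilinear x.
Lemma copairE a b : copair (tpure a b) = f a * g b.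
Proof. exact: (tliftE copair_bilinear). Qed.
Lemma copairD : {morph copair : x y / x + y}.
Proof. by move=> x y; rewrite /copair linearD. Qed.
Lemma copair_zmod : zmod_morphism copair.
Proof. by move=> x y; rewrite /copair linearB. Qed.
Lemma copair_monoid : monoid_morphism copair.
Proof.
split; first by rewrite copairE !rmorph1 mulr1.
elim/talg_ind=> [a b|x x' IH IH'] y; last by rewrite mulrDl !copairD mulrDl IH IH'.
elim/talg_ind: y => [a' b'|y y' IH IH']; last by rewrite mulrDr !copairD mulrDr IH IH'.
by rewrite talg_mulE !copairE !rmorphM mulrACA.
Qed.
HB.instance Definition _ := GRing.isZmodMorphism.Build (talg A B) C copair copair_zmod.
HB.instance Definition _ := GRing.isMonoidMorphism.Build (talg A B) C copair
  copair_monoid.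
Lemma copair_in a : copair (calg_in (calg_tens A B) a) = calg_in C a.
Proof. by rewrite copairE rmorph1 mulr1 calg_funE. Qed.
Definition calg_copair : calgHom (calg_tens A B) C :=
  @CalgHom (calg_tens A B) C copair copair_in.

Lemma calg_copair_inl : calg_comp calg_copair (calg_inl A B) = f.
Proof. by apply: calgHom_eq => a; rewrite /= copairE rmorph1 mulr1. Qed.
Lemma calg_copair_inr : calg_comp calg_copair (calg_inr A B) = g.
Proof. by apply: calgHom_eq => b; rewrite /= copairE rmorph1 mul1r. Qed.
End Copair.

Lemma calg_copair_uniq (C A B : calg) (h : calgHom (calg_tens A B) C) :
  calg_copair (calg_comp h (calg_inl A B)) (calg_comp h (calg_inr A B)) = h.
Proof.
apply: calgHom_eq; elim/talg_ind=> [a b|x y IHx IHy].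
  rewrite [LHS]copairE /= -rmorphM; congr (h _).
  by rewrite talg_mulE mulr1 mul1r.
by rewrite !rmorphD IHx IHy.
Qed.

Definition calg_k : calg := @Calg k idfun.
Definition calg_init (A : calg) : calgHom calg_k A :=
  @CalgHom calg_k A (calg_in A) (fun a => erefl).
Lemma calg_init_uniq (A : calg) (f : calgHom calg_k A) : f = calg_init A.
Proof. by apply: calgHom_eq => a; exact: (calg_funE f a). Qed.

Lemma calg_compA (A B C D : calg) (h : calgHom C D) (g : calgHom B C)
    (f : calgHom A B) :
  calg_comp (calg_comp h g) f = calg_comp h (calg_comp g f).
Proof. exact: calgHom_eq. Qed.
Lemma calg_comp1f (A B : calg) (f : calgHom A B) :
  calg_comp (calg_id B) f = f.
Proof. exact: calgHom_eq. Qed.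
Lemma calg_compf1 (A B : calg) (f : calgHom A B) :
  calg_comp f (calg_id A) = f.
Proof. exact: calgHom_eq. Qed.

(* Affine k-schemes, as the opposite of the category of commutative k-algebras:
   the object A stands for Spec A, and a morphism Spec A -> Spec B is a k-algebra
   morphism B -> A. *)
Definition aff_cat : category :=
  @Category calg (fun A B => calgHom B A) calg_id
    (fun A B C g f => calg_comp f g)
    (fun A B C D h g f => calg_compA f g h)
    (fun A B f => calg_compf1 f) (fun A B f => calg_comp1f f).

Definition AffSchCat : fpCategory :=
  @FpCategory aff_cat calg_k calg_init calg_init_uniq calg_tens
    calg_inl calg_inr (fun C A B f g => @calg_copair A B C f g)
    (fun C A B f g => @calg_copair_inl A B C f g)
    (fun C A B f g => @calg_copair_inr A B C f g)
    calg_copair_uniq.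

End Algebras.

Definition Hopf (k : fieldType) : category := Ab (CoalgCat k).
Definition AbSch (k : fieldType) : category := Ab (AffSchCat k).

Definition perfect_field (k : fieldType) : Prop :=
  forall p : {poly k}, irreducible_poly p -> separable_poly p.

(* Main.v *)
From HB Require Import structures.
From mathcomp Require Import all_boot all_algebra.
From mathcomp Require Import boolp.
From mathcomp Require classical_sets.
Require Import Defs.

Set Implicit Arguments.
Unset Strict Implicit.
Unset Printing Implicit Defensive.

Import GRing.Theory.
Local Open Scope ring_scope.
Local Open Scope quotient_scope.

(** The tensor product represents the functor B |-> Bil (A, A'; B), and its
    algebra is built directly: for Hopf algebras as a quotient of a free
    algebra, for affine groups as a subring of a product.

    For Hopf algebras, bilinearity extends to maps that are not maps of
    coalgebras. Linear maps from a coalgebra to a commutative algebra R form a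
    commutative monoid under convolution, and on coalgebra maps into a Hopf
    algebra convolution is the group law. So bilinearity makes sense for a
    linear map A (x) A' -> R into any commutative algebra; call such a map a
    pairing. Pairings with values in R form an abelian group under convolution,
    functorially in R, and this functor is represented by the commutative
    algebra T generated by A (x) A' subject to the relations that hold for all
    pairings ([ualg]). Hence Spec T is an abelian group scheme
    ([pairing_scheme]), its functions form a bicommutative Hopf algebra
    ([hopf_of]), and the universal pairing is a bilinear coalgebra map A (x) A'
    -> T. A bilinear coalgebra map into a Hopf algebra B is in particular a
    pairing, so it extends uniquely to an algebra map T -> B; on generators
    this is a coalgebra map, hence it is one ([hopf_tensor_product]).

    For affine groups, put X = A x A'.  A bilinear b : X -> B induces
    b_n : X^n -> B, (x_1, ..., x_n) |-> b x_1 + ... + b x_n.  A function on the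
    tensor product should be determined by its restrictions to the X^n, and
    every such function should come from some B.  So O(T) is defined as the set
    of those families (f_n) in the product of the O(X^n) that are of the form
    (b_n^* h) for some B, some bilinear b and some h in O(B).  It is a subring
    because two pairs (B, b) and (D, d) are projections of (B x D, (b, d)).
    A compatible family of maps Z -> B, one for each b, glues to a map Z -> T
    as soon as its effect on h depends only on the family (b_n^* h)
    ([tens_lift_exists]); this yields the sum, opposite, zero and the universal
    bilinear map.  For the sum, the restriction to X^n x X^m is b_(n + m), which
    depends only on the family; so what is needed is that a function on T x T
    is determined by its restrictions to the X^n x X^m.  This is linear
    algebra: over a field, if two families of linear maps are jointly
    injective, so are their tensor products ([tensor_jointly_injective]). *)

(** * Abelian group objects and their points *)

Section GroupObjects.
Variable C : fpCategory.

Lemma pair_pr (X Y : C) : pairc pr1 pr2 = idc (prodc X Y).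
Proof. by rewrite -[RHS]pair_uniq !compc1. Qed.

Lemma bang_comp (X Y : C) (f : hom X Y) : bang Y \oc f = bang X.
Proof. exact: bang_uniq. Qed.

(** A group structure on the points of [G] that is natural in the test object
    comes from a group object: the addition is the sum of the two projections.
    All group objects below are obtained in this way, so that their axioms are
    checked on points. *)
Section Yoneda.
Variables (G : C) (add : forall Z : C, hom Z G -> hom Z G -> hom Z G).
Variables (zero : forall Z : C, hom Z G)
  (opp : forall Z : C, hom Z G -> hom Z G).
Hypothesis add_comp : forall (Y Z : C) (x y : hom Z G) (h : hom Y Z),
  add x y \oc h = add (x \oc h) (y \oc h).
Hypothesis zero_comp : forall (Y Z : C) (h : hom Y Z), zero Z \oc h = zero Y.
Hypothesis addA : forall Z, associative (@add Z).
Hypothesis addC : forall Z, commutative (@add Z).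
Hypothesis add0 : forall Z, left_id (zero Z) (@add Z).
Hypothesis addN : forall Z, left_inverse (zero Z) (@opp Z) (@add Z).

Let m : hom (prodc G G) G := add pr1 pr2.
Let mE (Z : C) (x y : hom Z G) : m \oc pairc x y = add x y.
Proof. by rewrite add_comp pr1_pair pr2_pair. Qed.

Let mA : m \oc prodmap m (idc G) = m \oc prodmap (idc G) m \oc prodassoc _ _ _.
Proof.
rewrite -compcA prodmap_pair comp1c mE {1}/prodmap mE comp1c.
by rewrite mE addA; congr (@add _ _ _); rewrite add_comp.
Qed.
Let mC : m \oc prodswap _ _ = m.
Proof. by rewrite mE addC. Qed.
Let m0 : m \oc pairc (zero (term C) \oc bang G) (idc G) = idc G.
Proof. by rewrite mE zero_comp add0. Qed.
Let mN : m \oc pairc (opp (idc G)) (idc G) = zero (term C) \oc bang G.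
Proof. by rewrite mE zero_comp addN. Qed.

Definition abGroup_of : abGroup C := AbGroup mA mC m0 mN.

Lemma abGroup_of_gadd (Z : C) (x y : hom Z G) : gadd (A := abGroup_of) x y =
  add x y.
Proof. exact: mE. Qed.

End Yoneda.

Section Laws.
Variable A : abGroup C.

Definition gzero (Z : C) : hom Z A := ab_zero A \oc bang Z.
Definition gopp (Z : C) (x : hom Z A) : hom Z A := ab_opp A \oc x.

Lemma gzero_comp (Y Z : C) (h : hom Y Z) : gzero Z \oc h = gzero Y.
Proof. by rewrite /gzero -compcA bang_comp. Qed.

Lemma gaddA (Z : C) : associative (@gadd C A Z).
Proof.
move=> x y z; have := congr1 (fun f => f \oc pairc (pairc x y) z) (ab_addA A).
rewrite /prodassoc /prodmap !comp1c -!compcA !pair_comp -!compcA.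
by do !rewrite ?(pr1_pair, pr2_pair, pair_comp) -?compcA.
Qed.
Lemma gaddC (Z : C) : commutative (@gadd C A Z).
Proof.
move=> x y; rewrite /gadd -{1}(ab_addC A) -compcA /prodswap pair_comp.
by rewrite pr1_pair pr2_pair.
Qed.
Lemma gadd0 (Z : C) : left_id (gzero Z) (@gadd C A Z).
Proof.
move=> x; have := congr1 (fun f => f \oc x) (ab_add0 A).
by rewrite -compcA pair_comp comp1c -compcA bang_comp.
Qed.
Lemma gaddN (Z : C) : left_inverse (gzero Z) (@gopp Z) (@gadd C A Z).
Proof.
move=> x; have := congr1 (fun f => f \oc x) (ab_addN A).
by rewrite -compcA pair_comp comp1c -compcA bang_comp.
Qed.
Lemma gaddrN (Z : C) (x : hom Z A) : gadd x (gopp x) = gzero Z.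
Proof. by rewrite gaddC gaddN. Qed.
Lemma gaddr0 (Z : C) (x : hom Z A) : gadd x (gzero Z) = x.
Proof. by rewrite gaddC gadd0. Qed.
Lemma gaddACA (Z : C) : interchange (@gadd C A Z) (@gadd C A Z).
Proof.
by move=> x y z t; rewrite -!gaddA; congr gadd; rewrite !gaddA [gadd y z]gaddC.
Qed.
Lemma gaddI (Z : C) (x : hom Z A) : injective (gadd x).
Proof.
by move=> y z e; rewrite -[y]gadd0 -[z]gadd0 -(gaddN x) -!gaddA e.
Qed.
(** In a group only zero is idempotent; so additive maps preserve zero and
    bilinear maps vanish when one of the arguments is zero. *)
Lemma gadd_idem (Z : C) (x : hom Z A) : gadd x x = x -> x = gzero Z.
Proof. by move=> e; apply: (@gaddI _ x); rewrite gaddr0. Qed.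
Lemma gopp_uniq (Z : C) (x y : hom Z A) : gadd y x = gzero Z -> y = gopp x.
Proof. by move=> e; apply: (@gaddI _ x); rewrite gaddrN gaddC. Qed.

Lemma goppD (Z : C) (x y : hom Z A) : gopp (gadd x y) = gadd (gopp x) (gopp y).
Proof. by symmetry; apply: gopp_uniq; rewrite gaddACA !gaddN gadd0. Qed.

End Laws.

Arguments gzero : clear implicits.

Lemma abHom_gzero (A B : abGroup C) (f : abHom A B) (Z : C) :
  ab_hom f \oc gzero A Z = gzero B Z.
Proof. by apply: gadd_idem; rewrite -abHom_gadd gadd0. Qed.

(** Apply additivity on points to the two projections of [A x A]. *)
Lemma abHom_of_gadd (A B : abGroup C) (f : hom (ab_obj A) (ab_obj B)) :
  (forall (Z : C) (x y : hom Z A), f \oc gadd x y = gadd (f \oc x) (f \oc y)) ->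
  f \oc ab_add A = ab_add B \oc prodmap f f.
Proof. by move=> fD; rewrite -[in LHS](compc1 (ab_add A)) -pair_pr fD. Qed.

Section BilinearZero.
Variables (A A' B : abGroup C) (b : Bil A A' B) (Z : C).

Lemma bil0l (y : hom Z A') : b \oc pairc (gzero A Z) y = gzero B Z.
Proof. by apply: gadd_idem; rewrite -(bil_homP b Z).1 gadd0. Qed.
Lemma bil0r (x : hom Z A) : b \oc pairc x (gzero A' Z) = gzero B Z.
Proof. by apply: gadd_idem; rewrite -(bil_homP b Z).2 gadd0. Qed.
Lemma bilNl (x : hom Z A) (y : hom Z A') :
  b \oc pairc (gopp x) y = gopp (b \oc pairc x y).
Proof. by apply: gopp_uniq; rewrite -(bil_homP b Z).1 gaddN bil0l. Qed.

End BilinearZero.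

Section ProductGroup.
Variables B D : abGroup C.
Let BD : C := prodc (ab_obj B) (ab_obj D).
Let add (Z : C) (x y : hom Z BD) : hom Z BD :=
  pairc (gadd (pr1 \oc x) (pr1 \oc y)) (gadd (pr2 \oc x) (pr2 \oc y)).
Let zero (Z : C) : hom Z BD := pairc (gzero B Z) (gzero D Z).
Let opp (Z : C) (x : hom Z BD) : hom Z BD :=
  pairc (gopp (pr1 \oc x)) (gopp (pr2 \oc x)).

Let add_comp (Y Z : C) (x y : hom Z BD) (h : hom Y Z) :
  add x y \oc h = add (x \oc h) (y \oc h).
Proof. by rewrite pair_comp !gadd_comp -!compcA. Qed.
Let zero_comp (Y Z : C) (h : hom Y Z) : zero Z \oc h = zero Y.
Proof. by rewrite pair_comp !gzero_comp. Qed.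
Let addA Z : associative (@add Z).
Proof. by move=> x y z; rewrite /add !(pr1_pair, pr2_pair) !gaddA. Qed.
Let addC Z : commutative (@add Z).
Proof. by move=> x y; rewrite /add gaddC [X in pairc _ X]gaddC. Qed.
Let add0 Z : left_id (zero Z) (@add Z).
Proof. by move=> x; rewrite /add !(pr1_pair, pr2_pair) !gadd0 pair_uniq. Qed.
Let addN Z : left_inverse (zero Z) (@opp Z) (@add Z).
Proof. by move=> x; rewrite /add !(pr1_pair, pr2_pair) !gaddN. Qed.

Definition ab_prod : abGroup C :=
  abGroup_of add_comp zero_comp addA addC add0 addN.

Lemma ab_prod_gadd (Z : C) (x y : hom Z BD) : gadd (A := ab_prod) x y =
  pairc (gadd (pr1 \oc x) (pr1 \oc y)) (gadd (pr2 \oc x) (pr2 \oc y)).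
Proof. exact: abGroup_of_gadd. Qed.

End ProductGroup.

End GroupObjects.

Arguments gzero {C} A Z.

(** * Functions on products of affine schemes *)

Section AffineSchemes.
Variable k : fieldType.
Local Notation aff := (AffSchCat k).

(** A morphism of affine schemes is by definition an algebra map in the other
    direction; [pull] fixes this reading of it, as pullback of functions. *)
Definition pull (Y Z : aff) (f : hom Y Z) : calgHom Z Y := f.
Lemma pull_comp (Y Z W : aff) (g : hom Z W) (f : hom Y Z) w :
  pull (g \oc f) w = pull f (pull g w).
Proof. by []. Qed.
Lemma pull_eq (Y Z : aff) (f g : hom Y Z) : pull f =1 pull g -> f = g.
Proof. exact: calgHom_eq. Qed.

Section Linear.
Variables (R S : calg k) (f : calgHom R S).
Definition clin (x : calg_mod R) : calg_mod S := f x.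
Lemma clin_linear : linear clin.
Proof.
by move=> a x y; rewrite /clin calg_scaleE rmorphD rmorphM calg_funE.
Qed.
HB.instance Definition _ :=
  GRing.isLinear.Build k (calg_mod R) (calg_mod S) *:%R clin clin_linear.
End Linear.

Lemma calg_tens_scale (R S : calg k) (a : k) (t : calg_mod R \tens calg_mod S) :
  calg_in (calg_tens R S) a * (t : talg R S) = a *: t :> talg R S.
Proof.
elim/talg_ind: t => [x y|x y ex ey]; last by rewrite mulrDr scalerDr ex ey.
by rewrite [LHS]talg_mulE mul1r [tpure x y]/tpure -tensZl.
Qed.

Lemma pull_prodmap (Y Z Y' Z' : aff) (f : hom Y Y') (g : hom Z Z') t :
  pull (prodmap f g) t = tmap (clin (pull f)) (clin (pull g)) t.
Proof.
elim/talg_ind: t => [x y|x y ex ey].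
  by rewrite [RHS]tmapE [LHS]copairE /= [LHS]talg_mulE mulr1 mul1r.
by rewrite rmorphD ex ey -linearD.
Qed.

(** The algebra [calg_tens R S] has two scalar multiplications, one through its
    structure map and one as a tensor product of modules. They agree by
    [calg_tens_scale] but are not convertible; this identity map moves between
    them. *)
Section TensOfTalg.
Variables R S : calg k.
Definition tens_of_talg (t : calg_mod (calg_tens R S)) :
  calg_mod R \tens calg_mod S := t.
Lemma tens_of_talg_linear : linear tens_of_talg.
Proof. by move=> a x y; rewrite /tens_of_talg calg_scaleE calg_tens_scale. Qed.
HB.instance Definition _ := GRing.isLinear.Build k (calg_mod (calg_tens R S))
  (calg_mod R \tens calg_mod S) *:%R tens_of_talg tens_of_talg_linear.
End TensOfTalg.

Lemma pull_assoc (Y Z W : aff) t :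
  tmap (@tens_of_talg Y Z) (W := calg_mod W) idfun (pull (prodassoc Y Z W) t) =
  tassocV (tmap (V := calg_mod Y) idfun (@tens_of_talg Z W) t).
Proof.
elim/talg_ind: t => [x t|x y ex ey]; last by rewrite rmorphD !linearD /= ex ey.
rewrite [X in tassocV X]tmapE.
elim/talg_ind: t => [y z|y z ey ez].
  rewrite [RHS]tassocVE [pull _ _]copairE /= [calg_copair _ _ _]copairE /=.
  by rewrite !talg_mulE !(mul1r, mulr1) tmapE.
have -> : @tpure k Y (calg_tens Z W) x (y + z) =
    @tpure k Y (calg_tens Z W) x y + @tpure k Y (calg_tens Z W) x z.
  exact: (@tensDr k (calg_mod Y) (calg_mod (calg_tens Z W))).
by rewrite rmorphD linearD /= ey ez -linearD -tensDr.
Qed.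

End AffineSchemes.

(** * Linear functionals and tensors over a field *)

Section Functionals.
Variable k : fieldType.

Section Separation.
Variables (V : lmodType k) (M0 : V -> Prop) (w : V).
Hypothesis M00 : M0 0.
Hypothesis M0P : forall a x y, M0 x -> M0 y -> M0 (a *: x + y).
Hypothesis M0w : ~ M0 w.

Let subspace (M : V -> Prop) := forall a x y, M x -> M y -> M (a *: x + y).

(* By the lemma of Zorn, a subspace [M] that is maximal among those containing
   [M0] but not [w] has codimension one: for [x] outside [M], maximality puts
   [w] into [M + k x]. *)
Let maximal_avoiding : exists M : V -> Prop,
  [/\ subspace M, forall x, M0 x -> M x, ~ M w &
      forall x, ~ M x -> exists a, M (w - a *: x)].
Proof.
(* Zorn is applied to the sets [S] for which [M0 \/ S] is a suitable subspace,
   so that the empty chain needs no separate treatment. *)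
pose P (S : V -> Prop) := subspace (fun x => M0 x \/ S x) /\ ~ (M0 w \/ S w).
have [|A [[AP Aw] Amax]] := @classical_sets.Zorn_bigcup V P.
  move=> F FP Ftot; split=> [a x y|].
    have up X : F X -> forall z, M0 z \/ X z ->
        M0 z \/ classical_sets.bigcup F id z.
      by move=> FX z [|Xz]; [left | right; exists X].
    case=> [Mx|[X FX Xx]] [My|[Y FY Yy]].
    - by left; apply: M0P.
    - by apply: (up _ FY); apply: (FP _ FY).1; [left|right].
    - by apply: (up _ FX); apply: (FP _ FX).1; [right|left].
    - have [XY|YX] := Ftot _ _ FX FY.
        by apply: (up _ FY); apply: (FP _ FY).1; right; first exact: XY.
      by apply: (up _ FX); apply: (FP _ FX).1; right; last exact: YX.
  by case=> [//|[X FX Xw]]; apply: (FP _ FX).2; right.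
exists (fun x => M0 x \/ A x); split=> //; first by left.
move=> x Ax; pose B y := exists a, M0 (y - a *: x) \/ A (y - a *: x).
have A0 : M0 0 \/ A 0 by left.
have AB y : M0 y \/ A y -> B y by move=> Ay; exists 0; rewrite scale0r subr0.
apply: contrapT => nB; apply: (Amax B).
  split; first by move=> y Ay; apply: AB; right.
  move=> BA; apply: Ax; right; apply: BA.
  by exists 1; rewrite scale1r subrr.
have EB y : M0 y \/ B y -> B y by case=> [My|//]; apply: AB; left.
split; last by move/EB.
move=> a y z /EB[b yb] /EB[c zc]; right; exists (a * b + c).
have := AP a _ _ yb zc.
by rewrite scalerDl scalerBr scalerA opprD addrACA.
Qed.

(** The complement [M + k w] of the previous hyperplane gives the functional: it
    sends [x] to the coefficient [a] with [x - a w] in [M]. *)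
Lemma separating_functional :
  exists phi : {linear V -> k^o}, (forall x, M0 x -> phi x = 0) /\ phi w = 1.
Proof.
have [M [MP M0M Mw Mmax]] := maximal_avoiding.
have M_0 : M 0 by apply: M0M.
have MZ a x : M x -> M (a *: x) by move=> Mx; rewrite -[_ *: _]addr0; apply: MP.
have coef x : exists a : k^o, M (x - (a : k) *: w).
  have [Mx|/Mmax[a Ma]] := EM (M x); first by exists 0; rewrite scale0r subr0.
  have a0 : a != 0.
    by apply/eqP => a0; apply: Mw; rewrite a0 scale0r subr0 in Ma.
  exists a^-1; have := MZ (- a^-1) _ Ma.
  by rewrite scalerBr scalerA mulNr mulVf // scaleN1r opprK scaleNr addrC.
pose phi x : k^o := sval (cid (coef x)).
have phiP x : M (x - (phi x : k) *: w) by apply: (svalP (cid (coef x))).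
have phi_uniq x (a : k) : M (x - a *: w) -> phi x = a.
  move=> Ma; apply/eqP; rewrite -subr_eq0; apply/negPn/negP => ne; apply: Mw.
  have := MZ (- (phi x - a)^-1) _ (MP (-1) _ _ Ma (phiP x)).
  rewrite scaleN1r opprB addrA subrK -scalerBl scalerA.
  by rewrite -[a - _]opprB mulrNN mulVf // scale1r.
have phi_lin : linear phi.
  move=> a x y; apply: phi_uniq; have := MP a _ _ (phiP x) (phiP y).
  by rewrite scalerBr scalerA addrACA -opprD -scalerDl.
pose L := GRing.isLinear.Build k V k^o *:%R phi phi_lin.
exists (HB.pack_for {linear V -> k^o} phi L); split=> [x Mx|] /=;
  apply: phi_uniq.
  by rewrite scale0r subr0; apply: M0M.
by rewrite scale1r subrr.
Qed.

End Separation.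

Lemma functional_sep (V : lmodType k) (v : V) :
  (forall phi : {linear V -> k^o}, phi v = 0) -> v = 0.
Proof.
move=> v0; apply: contrapT => nv.
have [||//|phi [_ /eqP]] := @separating_functional V (fun x => x = 0) v.
- by [].
- by move=> a x y -> ->; rewrite scaler0 addr0.
by rewrite v0 eq_sym oner_eq0.
Qed.

Section Tensors.
Variables V W : lmodType k.

Lemma tens0l (w : W) : (0 : V) *t w = 0.
Proof. by rewrite -[X in X *t _](scale0r 0) tensZl scale0r. Qed.
Lemma tens0r (v : V) : v *t (0 : W) = 0.
Proof. by rewrite -[X in _ *t X](scale0r 0) tensZr scale0r. Qed.

Lemma tensor_sum (t : V \tens W) : exists n (v : nat -> V) (w : nat -> W),
  t = \sum_(i < n) v i *t w i.
Proof.
elim/tensor_ind: t => [v w|x y [n [v [w ->]]] [n' [v' [w' ->]]]].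
  by exists 1%N, (fun=> v), (fun=> w); rewrite big_ord1.
pose glue U (u u' : nat -> U) i := if (i < n)%N then u i else u' (i - n)%N.
exists (n + n')%N, (glue V v v'), (glue W w w'); rewrite big_split_ord /=.
congr (_ + _); apply: eq_bigr => i _; rewrite /glue; first by rewrite ltn_ord.
by rewrite ltnNge leq_addr /= addKn.
Qed.

(** Write the tensor as a sum of [n] pure tensors and induct on [n]. If the last
    [v n] is a combination of the others, the sum can be rewritten with [n]
    terms; otherwise a functional that kills the others and is 1 on [v n]
    recovers [w n], which is therefore zero. *)
Lemma tensor_sepl (t : V \tens W) :
  (forall phi : {linear V -> k^o}, tunit (tmap phi (W := W) idfun t) = 0) ->
  t = 0.
Proof.
have [n [v [w ->]]] := tensor_sum t.
elim: n w => [|n IHn] w tn; first by rewrite big_ord0.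
pose M x := exists c : nat -> k, x = \sum_(i < n) c i *: v i.
have [[c vn]|Mv] := EM (M (v n)).
  have E : \sum_(i < n.+1) v i *t w i = \sum_(i < n) v i *t (w i + c i *: w n).
    rewrite big_ord_recr /= vn
      (big_morph (fun x => x *t w n) (id1 := 0) (op1 := +%R)).
    - by rewrite -big_split; apply: eq_bigr => i _; rewrite !tensE.
    - by move=> x y; rewrite tensDl.
    - by rewrite tens0l.
  by rewrite E; apply: (IHn (fun i => w i + c i *: w n)) => phi; rewrite -E.
have [||//|phi [phi0 phi1]] := @separating_functional V M (v n).
- by exists (fun=> 0); rewrite big1 // => i _; rewrite scale0r.
- move=> a _ _ [c ->] [d ->]; exists (fun i => a * c i + d i).
  rewrite scaler_sumr -big_split; apply: eq_bigr => i _.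
  by rewrite scalerDl scalerA.
have E : tunit (tmap phi (W := W) idfun (\sum_(i < n.+1) v i *t w i)) = w n.
  rewrite big_ord_recr (linearD (tmap phi idfun)) (linearD (@tunit k W)) /=.
  rewrite tmapE tunitE phi1 scale1r.
  rewrite (linear_sum (tmap phi idfun)) (linear_sum (@tunit k W)) big1
    ?add0r //.
  move=> i _; rewrite /= tmapE tunitE phi0 ?scale0r //.
  exists (fun j => (j == i :> nat)%:R);
    rewrite (bigD1 i) //= eqxx scale1r big1 ?addr0 //.
  by move=> j ji; rewrite (_ : (j == i :> nat) = false) ?scale0r //;
    apply: negbTE.
have wn : w n = 0 by rewrite -E tn.
have E' : \sum_(i < n.+1) v i *t w i = \sum_(i < n) v i *t w i.
  by rewrite big_ord_recr /= wn tens0r addr0.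
by rewrite E'; apply: (IHn w) => psi; rewrite -E'.
Qed.

(** Functionals of the form [psi \o g j] separate the points of [W] and those of
    the form [chi \o f i] separate the points of [V], so that the claim can be
    tested by contracting one factor of [t] at a time. *)
Lemma tensor_jointly_injective (I J : Type) (V' : I -> lmodType k)
  (W' : J -> lmodType k)
    (f : forall i, {linear V -> V' i}) (g : forall j, {linear W -> W' j})
    (t : V \tens W) :
  (forall v, (forall i, f i v = 0) -> v = 0) ->
  (forall w, (forall j, g j w = 0) -> w = 0) ->
  (forall i j, tmap (f i) (g j) t = 0) -> t = 0.
Proof.
move=> finj ginj fgt; apply: tensor_sepl => phi; apply: ginj => j.
apply: functional_sep => psi.
transitivity (phi (tunit (tmap (psi \o g j) (W := V) idfun (tswap t)))).
  elim/tensor_ind: t {fgt} => [v w|x y]; last by rewrite !linearD /= => -> ->.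
  rewrite tswapE !tmapE !tunitE !linearZ /=; exact: mulrC.
rewrite (_ : tunit _ = 0) ?linear0 //; apply: finj => i.
apply: functional_sep => chi.
transitivity (tunit (tmap chi psi (tmap (f i) (g j) t))); last first.
  by rewrite fgt !linear0.
elim/tensor_ind: t {fgt} => [v w|x y]; last by rewrite !linearD /= => -> ->.
rewrite tswapE !tmapE !tunitE !linearZ /=; exact: mulrC.
Qed.

End Tensors.
End Functionals.

(** * Tensor products of affine abelian groups *)

(** The finite sums of values of a morphism [b : X -> B], as morphisms from the
    powers of [X]: they exhaust the subgroup generated by [b] when the set of
    values is stable under opposites, as it is for bilinear [b]. *)
Section Powers.
Variables (C : fpCategory) (X : C).

Fixpoint cpow n : C := if n is n'.+1 then prodc X (cpow n') else term C.

Fixpoint power_sum (B : abGroup C) (b : hom X B) n : hom (cpow n) B :=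
  if n is n'.+1 return hom (cpow n) B then gadd (b \oc pr1)
    (power_sum b n' \oc pr2)
  else gzero B (term C).

Fixpoint cpow_cat n m : hom (prodc (cpow n) (cpow m)) (cpow (n + m)) :=
  if n is n'.+1 return hom (prodc (cpow n) (cpow m)) (cpow (n + m))
  then pairc (pr1 \oc pr1) (cpow_cat n' m \oc pairc (pr2 \oc pr1) pr2) else pr2.

Fixpoint cpow_map (e : hom X X) n : hom (cpow n) (cpow n) :=
  if n is n'.+1 return hom (cpow n) (cpow n) then prodmap e (cpow_map e n')
  else idc (term C).

Lemma power_sum_cat (B : abGroup C) (b : hom X B) n m :
  power_sum b (n + m) \oc cpow_cat n m =
    gadd (power_sum b n \oc pr1) (power_sum b m \oc pr2).
Proof.
elim: n => [|n IHn] /=; first by rewrite gzero_comp gadd0.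
rewrite !gadd_comp -!compcA !(pr1_pair, pr2_pair) [X in gadd _ X]compcA IHn.
by rewrite gadd_comp -!compcA !(pr1_pair, pr2_pair) gaddA.
Qed.

Lemma power_sum1 (B : abGroup C) (b : hom X B) :
  power_sum b 1 \oc pairc (idc X) (bang X) = b.
Proof.
by rewrite /= gzero_comp gadd_comp gzero_comp -compcA pr1_pair gaddr0 compc1.
Qed.

Lemma power_sum_map (B : abGroup C) (b : hom X B) e n :
  power_sum b n \oc cpow_map e n = power_sum (b \oc e) n.
Proof.
elim: n => [|n IHn] /=; first by rewrite gzero_comp.
by rewrite gadd_comp -!compcA !(pr1_pair, pr2_pair) !compcA IHn.
Qed.

Lemma power_sum_opp (B : abGroup C) (b : hom X B) n : power_sum (gopp b) n =
  gopp (power_sum b n).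
Proof.
elim: n => [|n IHn] /=; first by apply: gopp_uniq; rewrite gadd0.
by rewrite goppD IHn /gopp !compcA.
Qed.

Lemma power_sum_hom (B D : abGroup C) (f : abHom B D) (b : hom X B) n :
  ab_hom f \oc power_sum b n = power_sum (ab_hom f \oc b) n.
Proof.
elim: n => [|n IHn] /=; first by rewrite abHom_gzero.
by rewrite abHom_gadd !compcA IHn.
Qed.

End Powers.

Section BilinearPairs.
Variables (C : fpCategory) (B D : abGroup C).

(** Two bilinear maps out of [A x A'] are projections of a single one, so that
    any two functions on the tensor product come from the same group. *)
Lemma ab_pr1D :
  pr1 \oc ab_add (ab_prod B D) = ab_add B \oc prodmap pr1 pr1.
Proof. by apply: abHom_of_gadd => Z x y; rewrite ab_prod_gadd pr1_pair. Qed.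
Lemma ab_pr2D :
  pr2 \oc ab_add (ab_prod B D) = ab_add D \oc prodmap pr2 pr2.
Proof. by apply: abHom_of_gadd => Z x y; rewrite ab_prod_gadd pr2_pair. Qed.
Definition ab_pr1 : abHom (ab_prod B D) B := AbHom ab_pr1D.
Definition ab_pr2 : abHom (ab_prod B D) D := AbHom ab_pr2D.

Lemma bil_pairP (A A' : abGroup C) (b : Bil A A' B) (d : Bil A A' D) :
  bilinear_hom (B := ab_prod B D) (pairc (bil_hom b) (bil_hom d)).
Proof.
move=> Z; have [bl br] := bil_homP b Z; have [dl dr] := bil_homP d Z.
split=> *; rewrite ab_prod_gadd !pair_comp !(pr1_pair, pr2_pair).
  by rewrite bl dl.
by rewrite br dr.
Qed.
Definition bil_pair (A A' : abGroup C) (b : Bil A A' B) (d : Bil A A' D) :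
  Bil A A' (ab_prod B D) := MkBil (bil_pairP b d).

Lemma bil_pair_pr1 (A A' : abGroup C) (b : Bil A A' B) (d : Bil A A' D) :
  ab_hom ab_pr1 \oc bil_hom (bil_pair b d) = bil_hom b.
Proof. exact: pr1_pair. Qed.
Lemma bil_pair_pr2 (A A' : abGroup C) (b : Bil A A' B) (d : Bil A A' D) :
  ab_hom ab_pr2 \oc bil_hom (bil_pair b d) = bil_hom d.
Proof. exact: pr2_pair. Qed.

Lemma bil_zeroP (A A' : abGroup C) :
  bilinear_hom (gzero B (prodc (ab_obj A) (ab_obj A'))).
Proof. by move=> Z; split=> *; rewrite !gzero_comp gadd0. Qed.
Definition bil_zero (A A' : abGroup C) : Bil A A' B := MkBil (bil_zeroP A A').

End BilinearPairs.

Section AffineTensor.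
Variable k : fieldType.
Local Notation aff := (AffSchCat k).

Variables A A' : AbSch k.
Let X : aff := prodc (ab_obj A) (ab_obj A').

(** [f n] plays the role of the restriction to the sums of [n] pure tensors of a
    function on the tensor product; it has to come from some group that receives
    a bilinear map. The quantifier ranges over all such groups, but since it
    stays in [Prop] the resulting functions form a set that is no larger than
    the product of the [cpow X n]. *)
Definition representable (f : forall n, (cpow X n : calg k)) :=
  exists (B : AbSch k) (b : Bil A A' B) (h : (ab_obj B : calg k)),
    forall n, f n = pull (power_sum (bil_hom b) n) h.

Lemma representable2 f g : representable f -> representable g ->
  exists (B : AbSch k) (b : Bil A A' B) (h h' : (ab_obj B : calg k)),
    (forall n, f n = pull (power_sum (bil_hom b) n) h) /\
    (forall n, g n = pull (power_sum (bil_hom b) n) h').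
Proof.
move=> [B [b [h fE]]] [D [d [h' gE]]]; exists (ab_prod B D), (bil_pair b d).
exists (pull (ab_hom (ab_pr1 B D)) h), (pull (ab_hom (ab_pr2 B D)) h').
by split=> n; rewrite -pull_comp power_sum_hom (bil_pair_pr1, bil_pair_pr2).
Qed.

Record tensfun := Tensfun {
  tensfun_at :> forall n, (cpow X n : calg k);
  tensfunP : representable tensfun_at }.

Lemma tensfun_eq (f g : tensfun) : (forall n, f n = g n) -> f = g.
Proof.
case: f g => [f fP] [g gP] /= fg;
  have {}fg : f = g by apply: functional_extensionality_dep.
by case: _ / fg in gP *; rewrite (Prop_irrelevance fP gP).
Qed.

HB.instance Definition _ := gen_eqMixin tensfun.
HB.instance Definition _ := gen_choiceMixin tensfun.

Lemma tensfun_addP (f g : tensfun) : representable (fun n => f n + g n).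
Proof.
have [B [b [h [h' [fE gE]]]]] := representable2 (tensfunP f) (tensfunP g).
by exists B, b, (h + h') => n; rewrite fE gE rmorphD.
Qed.
Lemma tensfun_mulP (f g : tensfun) : representable (fun n => f n * g n).
Proof.
have [B [b [h [h' [fE gE]]]]] := representable2 (tensfunP f) (tensfunP g).
by exists B, b, (h * h') => n; rewrite fE gE rmorphM.
Qed.
Lemma tensfun_oppP (f : tensfun) : representable (fun n => - f n).
Proof.
by have [B [b [h fE]]] := tensfunP f; exists B, b, (- h) => n;
  rewrite fE rmorphN.
Qed.
(* Constants come from any group; the zero pairing with values in [A] will do.
   *)
Lemma tensfun_inP (a : k) : representable (fun n => calg_in (cpow X n) a).
Proof.
exists A, (bil_zero A A A'), (calg_in (ab_obj A : calg k) a) => n.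
by rewrite calg_funE.
Qed.

Definition tensfun_add f g := Tensfun (tensfun_addP f g).
Definition tensfun_mul f g := Tensfun (tensfun_mulP f g).
Definition tensfun_opp f := Tensfun (tensfun_oppP f).
Definition tensfun_in a := Tensfun (tensfun_inP a).

Lemma tensfun_addA : associative tensfun_add.
Proof. by move=> f g h; apply: tensfun_eq => n; apply: addrA. Qed.
Lemma tensfun_addC : commutative tensfun_add.
Proof. by move=> f g; apply: tensfun_eq => n; apply: addrC. Qed.
Lemma tensfun_add0 : left_id (tensfun_in 0) tensfun_add.
Proof. by move=> f; apply: tensfun_eq => n; rewrite /= rmorph0 add0r. Qed.
Lemma tensfun_addN : left_inverse (tensfun_in 0) tensfun_opp tensfun_add.
Proof. by move=> f; apply: tensfun_eq => n; rewrite /= rmorph0 addNr. Qed.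
HB.instance Definition _ :=
  GRing.isZmodule.Build tensfun tensfun_addA tensfun_addC tensfun_add0
    tensfun_addN.

Lemma tensfun_mulA : associative tensfun_mul.
Proof. by move=> f g h; apply: tensfun_eq => n; apply: mulrA. Qed.
Lemma tensfun_mulC : commutative tensfun_mul.
Proof. by move=> f g; apply: tensfun_eq => n; apply: mulrC. Qed.
Lemma tensfun_mul1 : left_id (tensfun_in 1) tensfun_mul.
Proof. by move=> f; apply: tensfun_eq => n; rewrite /= rmorph1 mul1r. Qed.
Lemma tensfun_mulDl : left_distributive tensfun_mul tensfun_add.
Proof. by move=> f g h; apply: tensfun_eq => n; apply: mulrDl. Qed.
HB.instance Definition _ :=
  GRing.Zmodule_isComPzRing.Build tensfun tensfun_mulA tensfun_mulC tensfun_mul1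
    tensfun_mulDl.

Lemma tensfun_in_zmod : zmod_morphism tensfun_in.
Proof. by move=> a c; apply: tensfun_eq => n; rewrite /= rmorphB. Qed.
Lemma tensfun_in_monoid : monoid_morphism tensfun_in.
Proof. by split=> [//|a c]; apply: tensfun_eq => n; rewrite /= rmorphM. Qed.
HB.instance Definition _ :=
  GRing.isZmodMorphism.Build k tensfun tensfun_in tensfun_in_zmod.
HB.instance Definition _ :=
  GRing.isMonoidMorphism.Build k tensfun tensfun_in tensfun_in_monoid.

Definition tens_scheme : aff := @Calg k tensfun tensfun_in.

Section Inclusion.
Variable n : nat.
Definition tens_at (f : tensfun) : (cpow X n : calg k) := f n.
Lemma tens_at_zmod : zmod_morphism tens_at.
Proof. by []. Qed.
Lemma tens_at_monoid : monoid_morphism tens_at.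
Proof. by split=> //; apply: rmorph1. Qed.
HB.instance Definition _ :=
  GRing.isZmodMorphism.Build tensfun (cpow X n : calg k) tens_at tens_at_zmod.
HB.instance Definition _ :=
  GRing.isMonoidMorphism.Build tensfun (cpow X n : calg k) tens_at
    tens_at_monoid.
Definition tens_incl : hom (cpow X n) tens_scheme :=
  @CalgHom k tens_scheme (cpow X n) tens_at (fun a => erefl).
End Inclusion.

Section Map.
Variables (B : AbSch k) (b : Bil A A' B).
Definition tens_pull (h : (ab_obj B : calg k)) : tensfun :=
  @Tensfun (fun n => pull (power_sum (bil_hom b) n) h)
   (ex_intro _ B (ex_intro _ b (ex_intro _ h (fun n => erefl)))).
Lemma tens_pull_zmod : zmod_morphism tens_pull.
Proof. by move=> h h'; apply: tensfun_eq => n; rewrite /= rmorphB. Qed.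
Lemma tens_pull_monoid : monoid_morphism tens_pull.
Proof.
by split=> [|h h']; apply: tensfun_eq => n;
  rewrite /= (rmorph1, rmorphM) ?rmorph1.
Qed.
HB.instance Definition _ :=
  GRing.isZmodMorphism.Build (ab_obj B : calg k) tensfun tens_pull
    tens_pull_zmod.
HB.instance Definition _ :=
  GRing.isMonoidMorphism.Build (ab_obj B : calg k) tensfun tens_pull
    tens_pull_monoid.
Lemma tens_pull_in a : tens_pull (calg_in (ab_obj B : calg k) a) =
  calg_in tens_scheme a.
Proof. by apply: tensfun_eq => n; rewrite /= calg_funE. Qed.
Definition tens_proj : hom tens_scheme (ab_obj B) :=
  @CalgHom k (ab_obj B) tens_scheme tens_pull tens_pull_in.

Lemma tens_proj_incl n : tens_proj \oc tens_incl n = power_sum (bil_hom b) n.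
Proof. exact: pull_eq. Qed.
End Map.

Lemma tens_proj_surj2 (f g : tensfun) :
  exists (B : AbSch k) (b : Bil A A' B) h h',
  f = pull (tens_proj b) h /\ g = pull (tens_proj b) h'.
Proof.
have [B [b [h [h' [fE gE]]]]] := representable2 (tensfunP f) (tensfunP g).
by exists B, b, h, h'; split; apply: tensfun_eq.
Qed.

Lemma tens_proj_surj (f : tensfun) : exists (B : AbSch k) (b : Bil A A' B) h,
  f = pull (tens_proj b) h.
Proof.
by have [B [b [h [_ [-> _]]]]] := tens_proj_surj2 f f; exists B, b, h.
Qed.

(** The [tens_proj b] are jointly surjective on functions; identities between
    morphisms into the tensor product can thus be checked in each group [B]. *)
Lemma tens_proj_monic (Z : aff) (u v : hom Z tens_scheme) :
  (forall (B : AbSch k) (b : Bil A A' B), tens_proj b \oc u = tens_proj b \oc v)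
    -> u = v.
Proof.
move=> uv; apply: pull_eq => f; have [B [b [h ->]]] := tens_proj_surj f.
by rewrite -!pull_comp uv.
Qed.

Lemma tens_incl_epi (Z : aff) (u v : hom tens_scheme Z) :
  (forall n, u \oc tens_incl n = v \oc tens_incl n) -> u = v.
Proof.
move=> uv; apply: pull_eq => z; apply: tensfun_eq => n.
exact: (congr1 (fun w => pull w z) (uv n)).
Qed.

(** The tensor product is the limit of the groups [B] over all bilinear maps
    into them: a family of morphisms into the [B] glues as soon as it is
    compatible on functions. *)
Section Lift.
Variables (Z : aff) (u : forall B : AbSch k, Bil A A' B -> hom Z (ab_obj B)).
Hypothesis u_wd : forall B (b : Bil A A' B) D (d : Bil A A' D) h h',
  pull (tens_proj b) h = pull (tens_proj d) h' -> pull (u b) h = pull (u d) h'.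

Let lift (f : tensfun) : (Z : calg k) :=
  let: exist B F := cid (tens_proj_surj f) in
  let: exist b G := cid F in pull (u b) (sval (cid G)).

Let liftE B (b : Bil A A' B) h : lift (tens_pull b h) = pull (u b) h.
Proof.
by rewrite /lift; case: cid => D F; case: cid => d G; case: cid => h' /= /u_wd.
Qed.

Let lift_zmod : zmod_morphism lift.
Proof.
move=> f g; have [B [b [h [h' [-> ->]]]]] := tens_proj_surj2 f g.
by rewrite /= -rmorphB !liftE rmorphB.
Qed.
Let lift_monoid : monoid_morphism lift.
Proof.
split=> [|f g].
  by rewrite -(rmorph1 (tens_pull (bil_zero A A A'))) liftE rmorph1.
have [B [b [h [h' [-> ->]]]]] := tens_proj_surj2 f g.
by rewrite /= -rmorphM !liftE rmorphM.
Qed.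
HB.instance Definition _ :=
  GRing.isZmodMorphism.Build tensfun (Z : calg k) lift lift_zmod.
HB.instance Definition _ :=
  GRing.isMonoidMorphism.Build tensfun (Z : calg k) lift lift_monoid.
Let lift_in a : lift (calg_in tens_scheme a) = calg_in Z a.
Proof. by rewrite -(tens_pull_in (bil_zero A A A')) liftE calg_funE. Qed.

Lemma tens_lift_exists : exists v :
  hom Z tens_scheme, forall B (b : Bil A A' B),
  tens_proj b \oc v = u b.
Proof.
by exists (@CalgHom k tens_scheme Z lift lift_in) => B b; apply: pull_eq => h;
  apply: liftE.
Qed.
End Lift.


(** The morphisms from the [X^n] to the tensor product are jointly injective on
    functions by definition; over a field, so are their products. *)
Lemma tens_incl2_inj (t t' : talg tens_scheme tens_scheme) :
  (forall n m, pull (prodmap (tens_incl n) (tens_incl m)) t =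
               pull (prodmap (tens_incl n) (tens_incl m)) t') -> t = t'.
Proof.
move=> tt'; apply: subr0_eq.
have inj (f : calg_mod tens_scheme) : (forall n, clin (pull (tens_incl n)) f =
  0) -> f = 0.
  by move=> f0; apply: tensfun_eq => n; rewrite [LHS]f0 /= rmorph0.
apply: (tensor_jointly_injective inj inj) => n m.
by have /eqP := tt' n m; rewrite -subr_eq0 -rmorphB pull_prodmap => /eqP.
Qed.

Lemma tens_add_exists : exists v :
  hom (prodc tens_scheme tens_scheme) tens_scheme,
  forall B (b : Bil A A' B), tens_proj b \oc v =
    gadd (tens_proj b \oc pr1) (tens_proj b \oc pr2).
Proof.
(* On [X^n x X^m] the sum of two sums is a sum of [n + m] terms, on which the
   two functions agree by assumption. *)
apply: tens_lift_exists => B b D d h h' hh'; apply: tens_incl2_inj => n m.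
have E E' (e : Bil A A' E') : gadd (tens_proj e \oc pr1) (tens_proj e \oc pr2)
    \oc prodmap (tens_incl n) (tens_incl m) =
    tens_proj e \oc (tens_incl (n + m) \oc cpow_cat X n m).
  rewrite gadd_comp -!compcA pr1_pair pr2_pair !compcA !tens_proj_incl.
  by rewrite power_sum_cat.
by rewrite -!pull_comp !E !pull_comp hh'.
Qed.

Lemma tens_opp_exists : exists v : hom tens_scheme tens_scheme,
  forall B (b : Bil A A' B), tens_proj b \oc v = gopp (tens_proj b).
Proof.
apply: tens_lift_exists => B b D d h h' hh'; apply: tensfun_eq => n.
(* By bilinearity, the opposite of a sum of pure tensors is the sum of the pure
   tensors with the first factors negated. *)
pose e : hom X X := pairc (gopp pr1) pr2.
have E E' (c : Bil A A' E') : gopp (tens_proj c) \oc tens_incl n =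
    tens_proj c \oc (tens_incl n \oc cpow_map e n).
  rewrite /gopp -compcA tens_proj_incl -/(gopp _) -power_sum_opp compcA
    tens_proj_incl power_sum_map.
  by rewrite bilNl pair_pr compc1.
have := congr1 (pull (tens_incl n \oc cpow_map e n)) hh'.
by rewrite -!pull_comp -!E.
Qed.

Lemma tens_zero_exists : exists v : hom (term aff) tens_scheme,
  forall B (b : Bil A A' B), tens_proj b \oc v = gzero B _.
Proof.
apply: tens_lift_exists => B b D d h h' hh'.
by have := congr1 (pull (tens_incl 0)) hh'; rewrite -!pull_comp !tens_proj_incl.
Qed.

Lemma tens_bil_exists : exists v : hom X tens_scheme,
  forall B (b : Bil A A' B), tens_proj b \oc v = bil_hom b.
Proof.
apply: tens_lift_exists => B b D d h h' hh'.
have E E' (c : Bil A A' E') :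
    tens_proj c \oc (tens_incl 1 \oc pairc (idc X) (bang X)) = bil_hom c.
  by rewrite compcA tens_proj_incl power_sum1.
have := congr1 (pull (tens_incl 1 \oc pairc (idc X) (bang X))) hh'.
by rewrite -!pull_comp !E.
Qed.

Let tens_add := sval (cid tens_add_exists).
Let tens_opp := sval (cid tens_opp_exists).
Let tens_zero := sval (cid tens_zero_exists).

Let add (Z : aff) (x y : hom Z tens_scheme) := tens_add \oc pairc x y.
Let zero (Z : aff) : hom Z tens_scheme := tens_zero \oc bang Z.
Let opp (Z : aff) (x : hom Z tens_scheme) := tens_opp \oc x.

Let tens_projD (Z : aff) (x y : hom Z tens_scheme) (B : AbSch k)
  (b : Bil A A' B) :
  tens_proj b \oc add x y = gadd (tens_proj b \oc x) (tens_proj b \oc y).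
Proof.
rewrite /add compcA (svalP (cid tens_add_exists)).
by rewrite gadd_comp -!compcA pr1_pair pr2_pair.
Qed.
Let tens_proj0 (Z : aff) (B : AbSch k) (b : Bil A A' B) :
  tens_proj b \oc zero Z = gzero B Z.
Proof. by rewrite /zero compcA (svalP (cid tens_zero_exists)) gzero_comp. Qed.
Let tens_projN (Z : aff) (x : hom Z tens_scheme) (B : AbSch k)
  (b : Bil A A' B) :
  tens_proj b \oc opp x = gopp (tens_proj b \oc x).
Proof. by rewrite /opp compcA (svalP (cid tens_opp_exists)) /gopp compcA. Qed.

Let add_comp (Y Z : aff) (x y : hom Z tens_scheme) (h : hom Y Z) :
  add x y \oc h = add (x \oc h) (y \oc h).
Proof. by rewrite /add -compcA pair_comp. Qed.
Let zero_comp (Y Z : aff) (h : hom Y Z) : zero Z \oc h = zero Y.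
Proof. by rewrite /zero -compcA bang_comp. Qed.
Let addA Z : associative (@add Z).
Proof.
by move=> x y z; apply: tens_proj_monic => B b; rewrite !tens_projD gaddA.
Qed.
Let addC Z : commutative (@add Z).
Proof.
by move=> x y; apply: tens_proj_monic => B b; rewrite !tens_projD gaddC.
Qed.
Let add0 Z : left_id (zero Z) (@add Z).
Proof.
by move=> x; apply: tens_proj_monic => B b;
  rewrite !tens_projD tens_proj0 gadd0.
Qed.
Let addN Z : left_inverse (zero Z) (@opp Z) (@add Z).
Proof.
by move=> x; apply: tens_proj_monic => B b;
  rewrite !tens_projD tens_projN tens_proj0 gaddN.
Qed.

Definition affine_tensor : AbSch k :=
  abGroup_of add_comp zero_comp addA addC add0 addN.

Lemma affine_tensor_gadd (Z : aff) (x y : hom Z tens_scheme) B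
  (b : Bil A A' B) :
  tens_proj b \oc gadd (A := affine_tensor) x y =
    gadd (tens_proj b \oc x) (tens_proj b \oc y).
Proof. by rewrite abGroup_of_gadd tens_projD. Qed.

Lemma tens_proj_homD (B : AbSch k) (b : Bil A A' B) :
  tens_proj b \oc ab_add affine_tensor =
    ab_add B \oc prodmap (tens_proj b) (tens_proj b).
Proof.
by apply: (@abHom_of_gadd _ affine_tensor) => Z x y; apply: affine_tensor_gadd.
Qed.
Definition tens_proj_hom (B : AbSch k) (b : Bil A A' B) :
  abHom affine_tensor B :=
  AbHom (tens_proj_homD b).

Let a : hom X tens_scheme := sval (cid tens_bil_exists).
Let tens_proj_a B (b : Bil A A' B) : tens_proj b \oc a = bil_hom b.
Proof. exact: (svalP (cid tens_bil_exists)). Qed.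
Let aP : bilinear_hom (B := affine_tensor) a.
Proof.
move=> Z; split=> *; apply: tens_proj_monic => B b;
  rewrite affine_tensor_gadd !compcA tens_proj_a.
  by rewrite (bil_homP b Z).1.
by rewrite (bil_homP b Z).2.
Qed.
Definition affine_tensor_bil : Bil A A' affine_tensor := MkBil aP.

(** Now that the tensor product is a group, its points coming from [X^n] are
    indeed sums of [n] pure tensors. As they are jointly epic by
    [tens_incl_epi], homomorphisms out of the tensor product are determined by
    their values on pure tensors. *)
Lemma tens_incl_power_sum n : tens_incl n = power_sum (B := affine_tensor) a n.
Proof.
apply: tens_proj_monic => B b; rewrite tens_proj_incl.
by rewrite (power_sum_hom (tens_proj_hom b)) tens_proj_a.
Qed.

Theorem affine_tensor_product : is_tensor_product affine_tensor_bil.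
Proof.
move=> B; exists (fun b => tens_proj_hom b) => [f|b].
  apply: abHom_eq; apply: tens_incl_epi => n.
  by rewrite tens_proj_incl tens_incl_power_sum (power_sum_hom f).
by apply: Bil_eq; apply: tens_proj_a.
Qed.

End AffineTensor.

(** * Commutative algebras presented by linear maps, and convolution *)

(** The commutative algebra that is universal for a class [adm] of linear maps
    from [V] to commutative algebras. Polynomial expressions in elements of [V]
    are identified when every admissible map gives them the same value. The
    generating map [ugen] need not itself be admissible: this holds when
    admissibility can be tested after composition with a family of algebra maps
    that separates points, as in [pairing_genP]. *)
Section UniversalAlgebra.
Variables (k : fieldType) (V : lmodType k).
Variable adm : forall R : calg k, {linear V -> calg_mod R} -> Prop.

Inductive uterm :=
  UGen of V | UCst of k | UAdd of uterm & uterm | UMul of uterm & uterm.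

Fixpoint ueval (R : calg k) (f : V -> R) t : R :=
  match t with
  | UGen v => f v
  | UCst a => calg_in R a
  | UAdd s t => ueval f s + ueval f t
  | UMul s t => ueval f s * ueval f t
  end.

HB.instance Definition _ := gen_eqMixin uterm.
HB.instance Definition _ := gen_choiceMixin uterm.

Definition ueqv (s t : uterm) : bool :=
  `[< forall (R : calg k) (f : {linear V -> calg_mod R}), adm f ->
      ueval (R := R) f s = ueval (R := R) f t >].

Lemma ueqv_refl : reflexive ueqv.
Proof. by move=> s; apply/asboolP. Qed.
Lemma ueqv_sym : symmetric ueqv.
Proof.
by move=> s t; apply/asboolP/asboolP => st R f fA; rewrite (st R f fA).
Qed.
Lemma ueqv_trans : transitive ueqv.
Proof.
move=> t s u /asboolP st /asboolP tu; apply/asboolP => R f fA.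
by rewrite (st R f fA) (tu R f fA).
Qed.
Canonical ueqv_equiv := EquivRel ueqv ueqv_refl ueqv_sym ueqv_trans.

Definition uring : Type := {eq_quot ueqv}.
HB.instance Definition _ := Choice.on uring.
HB.instance Definition _ := EqQuotient.on uring.

Definition uclass (t : uterm) : uring := \pi_uring t.
Definition uval (R : calg k) (f : V -> R) (x : uring) : R := ueval f (repr x).

Lemma uring_sep (x y : uring) :
  (forall (R : calg k) (f : {linear V -> calg_mod R}), adm f ->
     uval (R := R) f x = uval (R := R) f y) -> x = y.
Proof. by move=> xy; rewrite -[x]reprK -[y]reprK; apply/eqmodP/asboolP. Qed.

Lemma uval_class (R : calg k) (f : {linear V -> calg_mod R}) t :
  adm f -> uval (R := R) f (uclass t) = ueval (R := R) f t.
Proof.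
move=> fA; have /eqmodP/asboolP : repr (uclass t) =
  t %[mod uring] by rewrite reprK.
exact.
Qed.

Definition uadd (x y : uring) := uclass (UAdd (repr x) (repr y)).
Definition umul (x y : uring) := uclass (UMul (repr x) (repr y)).
Definition ucst a := uclass (UCst a).
Definition uopp x := umul (ucst (-1)) x.

Lemma uvalD (R : calg k) (f : {linear V -> calg_mod R}) x y : adm f ->
  uval (R := R) f (uadd x y) = uval (R := R) f x + uval (R := R) f y.
Proof. exact: uval_class. Qed.
Lemma uvalM (R : calg k) (f : {linear V -> calg_mod R}) x y : adm f ->
  uval (R := R) f (umul x y) = uval (R := R) f x * uval (R := R) f y.
Proof. exact: uval_class. Qed.
Lemma uvalC (R : calg k) (f : {linear V -> calg_mod R}) a : adm f ->
  uval (R := R) f (ucst a) = calg_in R a.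
Proof. exact: uval_class. Qed.

Lemma uaddA : associative uadd.
Proof.
by move=> x y z; apply: uring_sep => R f fA; rewrite !uvalD // addrA.
Qed.
Lemma uaddC : commutative uadd.
Proof. by move=> x y; apply: uring_sep => R f fA; rewrite !uvalD // addrC. Qed.
Lemma uadd0 : left_id (ucst 0) uadd.
Proof.
by move=> x; apply: uring_sep => R f fA;
  rewrite uvalD // uvalC // rmorph0 add0r.
Qed.
Lemma uaddN : left_inverse (ucst 0) uopp uadd.
Proof.
move=> x; apply: uring_sep => R f fA.
by rewrite uvalD // uvalM // !uvalC // rmorphN rmorph1 rmorph0 mulN1r addNr.
Qed.
HB.instance Definition _ := GRing.isZmodule.Build uring uaddA uaddC uadd0 uaddN.

Lemma umulA : associative umul.
Proof.
by move=> x y z; apply: uring_sep => R f fA; rewrite !uvalM // mulrA.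
Qed.
Lemma umulC : commutative umul.
Proof. by move=> x y; apply: uring_sep => R f fA; rewrite !uvalM // mulrC. Qed.
Lemma umul1 : left_id (ucst 1) umul.
Proof.
by move=> x; apply: uring_sep => R f fA;
  rewrite uvalM // uvalC // rmorph1 mul1r.
Qed.
Lemma umulDl : left_distributive umul uadd.
Proof.
move=> x y z; apply: uring_sep => R f fA.
by rewrite uvalM // !uvalD // !uvalM // mulrDl.
Qed.
HB.instance Definition _ :=
  GRing.Zmodule_isComPzRing.Build uring umulA umulC umul1 umulDl.

Lemma ucst_zmod : zmod_morphism ucst.
Proof.
move=> a b; apply: uring_sep => R f fA.
by rewrite uvalD // uvalM // !uvalC // rmorphN rmorph1 mulN1r rmorphB.
Qed.
Lemma ucst_monoid : monoid_morphism ucst.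
Proof.
split=> // a b; apply: uring_sep => R f fA.
by rewrite uvalM // !uvalC // rmorphM.
Qed.
HB.instance Definition _ := GRing.isZmodMorphism.Build k uring ucst ucst_zmod.
HB.instance Definition _ :=
  GRing.isMonoidMorphism.Build k uring ucst ucst_monoid.

Definition ualg : calg k := @Calg k uring ucst.

Definition ugen (v : V) : calg_mod ualg := uclass (UGen v).
Lemma ugen_linear : linear ugen.
Proof.
move=> a v w; apply: uring_sep => R f fA.
rewrite uvalD // uvalM // uvalC // !uval_class //=.
by rewrite linearP.
Qed.
HB.instance Definition _ :=
  GRing.isLinear.Build k V (calg_mod ualg) *:%R ugen ugen_linear.

Section Eval.
Variables (R : calg k) (f : {linear V -> calg_mod R}) (fA : adm f).
(* The dummy let makes [uev_fun] depend on [fA], so that it is canonically a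
   ring morphism. *)
Definition uev_fun (x : uring) : R := let _ := fA in uval (R := R) f x.
Lemma uev_zmod : zmod_morphism uev_fun.
Proof.
by move=> x y;
  rewrite /uev_fun uvalD // uvalM // uvalC // rmorphN rmorph1 mulN1r.
Qed.
Lemma uev_monoid : monoid_morphism uev_fun.
Proof.
by split=> [|x y]; rewrite /uev_fun; [rewrite uvalC // rmorph1 | rewrite uvalM].
Qed.
HB.instance Definition _ := GRing.isZmodMorphism.Build uring R uev_fun uev_zmod.
HB.instance Definition _ :=
  GRing.isMonoidMorphism.Build uring R uev_fun uev_monoid.
Lemma uev_in a : uev_fun (calg_in ualg a) = calg_in R a.
Proof. exact: uvalC. Qed.
Definition uev : calgHom ualg R := @CalgHom k ualg R uev_fun uev_in.
Lemma uev_gen v : uev (ugen v) = f v.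
Proof. exact: uval_class. Qed.
End Eval.

(** The evaluations at admissible maps separate points: this is how identities
    in [ualg] are proved without looking at expressions. *)
Lemma ualg_sep (x y : ualg) :
  (forall (R : calg k) (f : {linear V -> calg_mod R}) (fA : adm f),
     uev fA x = uev fA y) -> x = y.
Proof. by move=> xy; apply: uring_sep => R f fA; apply: (xy R f fA). Qed.

Lemma ualg_ind (P : ualg -> Prop) :
  (forall v, P (ugen v)) -> (forall a, P (calg_in ualg a)) ->
  (forall x y, P x -> P y -> P (x + y)) ->
    (forall x y, P x -> P y -> P (x * y)) ->
  forall x, P x.
Proof.
move=> Pg Pc PD PM x; rewrite -[x]reprK -/(uclass _).
elim: (repr x) => [v|a|s Ps t Pt|s Ps t Pt].
- exact: Pg.
- exact: Pc.
- rewrite (_ : uclass _ = (uclass s : ualg) + uclass t); first exact: PD.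
  by apply: uring_sep => R f fA; rewrite uvalD // !uval_class.
- rewrite (_ : uclass _ = (uclass s : ualg) * uclass t); first exact: PM.
  by apply: uring_sep => R f fA; rewrite uvalM // !uval_class.
Qed.

Lemma ualg_ext (R : calg k) (g h : calgHom ualg R) :
  (forall v, g (ugen v) = h (ugen v)) -> g = h.
Proof.
move=> gh; apply: calgHom_eq; elim/ualg_ind => [//|a|x y ex ey|x y ex ey].
- by rewrite !calg_funE.
- by rewrite !rmorphD ex ey.
- by rewrite !rmorphM ex ey.
Qed.

End UniversalAlgebra.

Section Convolution.
Variable k : fieldType.
Local Notation cat := (CoalgCat k).

Section Conv.
Variables (C : coalg k) (R : calg k).
Implicit Types f g h : {linear C -> calg_mod R}.

(** The product of [f] and [g] sends [c] to the sum of the [f c_1 * g c_2],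
    where the comultiplication of [c] is the sum of the [c_1 (x) c_2]. *)
Definition conv f g : {linear C -> calg_mod R} :=
  @calg_mult k R \o (tmap f g \o comul C).
Lemma convE f g x : conv f g x = calg_mult (tmap f g (comul C x)).
Proof. by []. Qed.

Definition cunit_fun (x : C) : calg_mod R := calg_in R (counit C x).
Lemma cunit_linear : linear cunit_fun.
Proof. by move=> a x y; rewrite /cunit_fun linearP rmorphD rmorphM. Qed.
HB.instance Definition _ :=
  GRing.isLinear.Build k C (calg_mod R) *:%R cunit_fun cunit_linear.
Definition cunit : {linear C -> calg_mod R} := cunit_fun.

Lemma convC : commutative conv.
Proof.
move=> f g; apply: linear_eq => x; rewrite !convE -[in LHS]comulC.
elim/tensor_ind: (comul C x) => [y z|y z]; last by rewrite !linearD /= => -> ->.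
by rewrite tswapE !tmapE !calg_multE mulrC.
Qed.

Lemma convA : associative conv.
Proof.
move=> f g h; apply: linear_eq => x; rewrite !convE.
have L t : calg_mult (tmap f (conv g h) t) =
    calg_mult (tmap f (@calg_mult k R \o tmap g h)
      (tmap (V := C) idfun (comul C) t)).
  by rewrite tmap_comp; congr calg_mult; apply: tmap_eq.
have M t : calg_mult (tmap (conv f g) h t) =
    calg_mult (tmap (@calg_mult k R \o tmap f g) h
      (tmap (comul C) (W := C) idfun t)).
  by rewrite tmap_comp; congr calg_mult; apply: tmap_eq.
rewrite L M -comulA; elim/tensor_ind: (tmap _ _ (comul C x)) => [y z|y z];
  last first.
  by rewrite !linearD /= => -> ->.
elim/tensor_ind: y => [y y'|y y'];
  last by rewrite !(tensE, linearD) /= => -> ->.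
by rewrite tassocE !tmapE /= !tmapE !calg_multE mulrA.
Qed.

Lemma conv1 : left_id cunit conv.
Proof.
move=> f; apply: linear_eq => x; rewrite convE -[in RHS](counitl x).
elim/tensor_ind: (comul C x) => [y z|y z]; last by rewrite !linearD /= => -> ->.
by rewrite !tmapE calg_multE tunitE linearZ.
Qed.

Lemma convACA : interchange conv conv.
Proof.
by move=> x y z t; rewrite -!convA; congr conv; rewrite !convA [conv y z]convC.
Qed.

End Conv.

Arguments cunit : clear implicits.

Definition precomp (C D : coalg k) (R : calg k) (f : {linear C -> calg_mod R})
  (h : coalgHom D C) : {linear D -> calg_mod R} := f \o h.

Definition postcomp (C : coalg k) (R S : calg k) (phi : calgHom R S)
  (f : {linear C -> calg_mod R}) : {linear C -> calg_mod S} := clin phi \o f.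

Section Theory.
Variables (C D : coalg k) (R S : calg k).
Implicit Types (f g : {linear C -> calg_mod R}) (h : coalgHom D C).

Lemma precomp_conv f g h : precomp (conv f g) h =
  conv (precomp f h) (precomp g h).
Proof.
apply: linear_eq => x; rewrite convE /= coalg_comul tmap_comp.
by congr calg_mult; apply: tmap_eq.
Qed.
Lemma precomp_cunit h : precomp (cunit C R) h = cunit D R.
Proof. by apply: linear_eq => x; rewrite /= /cunit_fun coalg_counit. Qed.
Lemma postcomp_conv (phi : calgHom R S) f g :
  postcomp phi (conv f g) = conv (postcomp phi f) (postcomp phi g).
Proof.
apply: linear_eq => x; rewrite /=.
elim/tensor_ind: (comul C x) => [y z|y z]; last by rewrite !linearD /= => -> ->.
by rewrite !tmapE !calg_multE /= /clin rmorphM.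
Qed.
Lemma postcomp_cunit (phi : calgHom R S) : postcomp phi (cunit C R) = cunit C S.
Proof. by apply: linear_eq => x; rewrite /= /clin /cunit_fun calg_funE. Qed.
Lemma postcomp_precomp (phi : calgHom R S) f h : postcomp phi (precomp f h) =
  precomp (postcomp phi f) h.
Proof. exact: linear_eq. Qed.
End Theory.

Lemma precomp_comp (C D E : coalg k) (R : calg k) (f : {linear C -> calg_mod R})
    (h : hom (c := cat) D C) (g : hom (c := cat) E D) :
  precomp f (h \oc g) = precomp (precomp f h) g.
Proof. exact: linear_eq. Qed.
Lemma precomp_id (C : coalg k) (R : calg k) (f : {linear C -> calg_mod R}) :
  precomp f (idc (C : cat)) = f.
Proof. exact: linear_eq. Qed.

End Convolution.

Arguments cunit {k} C R.

(** * The Hopf algebra of functions on an affine abelian group *)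

Section HopfOfGroupScheme.
Variables (k : fieldType) (G : AbSch k).
Local Notation O := (calg_mod (ab_obj G)).

Local Notation cat := (CoalgCat k).

Definition scomul (x : O) : O \tens O := pull (ab_add G) x.
Lemma scomul_linear : linear scomul.
Proof.
move=> a x y; rewrite /scomul calg_scaleE rmorphD rmorphM calg_funE.
by rewrite calg_tens_scale.
Qed.
HB.instance Definition _ :=
  GRing.isLinear.Build k O (O \tens O) *:%R scomul scomul_linear.

Definition scounit (x : O) : k^o := pull (ab_zero G) x.
Lemma scounit_linear : linear scounit.
Proof.
by move=> a x y; rewrite /scounit calg_scaleE rmorphD rmorphM calg_funE.
Qed.
HB.instance Definition _ :=
  GRing.isLinear.Build k O k^o *:%R scounit scounit_linear.

Definition santipode (x : O) : O := pull (ab_opp G) x.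
Lemma santipode_linear : linear santipode.
Proof.
by move=> a x y; rewrite /santipode calg_scaleE rmorphD rmorphM calg_funE.
Qed.
HB.instance Definition _ :=
  GRing.isLinear.Build k O O *:%R santipode santipode_linear.

Lemma scomulA c : tassoc (tmap scomul (W := O) idfun (scomul c)) =
                  tmap (V := O) idfun scomul (scomul c).
Proof.
have E1 t : tmap scomul (W := O) idfun t =
  tmap (@tens_of_talg _ _ _) (W := O) idfun
    (pull (prodmap (ab_add G) (idc (ab_obj G))) t).
  by rewrite pull_prodmap tmap_comp; apply: tmap_eq.
have E2 t : tmap (V := O) idfun scomul t =
  tmap (V := O) idfun (@tens_of_talg _ _ _)
    (pull (prodmap (idc (ab_obj G)) (ab_add G)) t).
  by rewrite pull_prodmap tmap_comp; apply: tmap_eq.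
have := congr1 (fun f => pull f c) (ab_addA G); rewrite !pull_comp => E.
by rewrite E1 [pull (prodmap _ _) _]E pull_assoc tassocVK E2.
Qed.
Lemma scomulC c : tswap (scomul c) = scomul c.
Proof.
have := congr1 (fun f => pull f c) (ab_addC G).
rewrite pull_comp -/(scomul c) => {2}<-.
elim/tensor_ind: (scomul c) => [x y|x y ex ey]; last first.
  rewrite linearD /= ex ey; symmetry;
    exact: (rmorphD (pull (prodswap (ab_obj G) (ab_obj G)))).
by rewrite tswapE [RHS]copairE [RHS]talg_mulE mul1r mulr1.
Qed.
Lemma scounitl c : tunit (tmap scounit (W := O) idfun (scomul c)) = c.
Proof.
have := congr1 (fun f => pull f c) (ab_add0 G).
rewrite pull_comp -/(scomul c) => E; apply: etrans E.
elim/tensor_ind: (scomul c) => [x y|x y ex ey]; last first.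
  by rewrite !linearD /= ex ey; symmetry; apply: (rmorphD (pull (pairc _ _))).
by rewrite tmapE tunitE [RHS]copairE.
Qed.

Definition scoalg : coalg k :=
  @Coalg k O scomul scounit scomulA scomulC scounitl.

(** The comultiplication of functions is a ring map: read the other way round,
    the multiplication of functions is a coalgebra map. *)
Lemma smul_comul x : comul scoalg (calg_mult x) =
  tmap (@calg_mult k _) (@calg_mult k _) (comul (coalg_prod scoalg scoalg) x).
Proof.
elim/tensor_ind: x => [x y|x y ex ey]; last by rewrite !linearD /= ex ey.
by rewrite calg_multE /= pcomulE /scomul rmorphM.
Qed.
Lemma smul_counit x :
  counit scoalg (calg_mult x) = counit (coalg_prod scoalg scoalg) x.
Proof.
elim/tensor_ind: x => [x y|x y ex ey]; last by rewrite !linearD /= ex ey.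
by rewrite calg_multE /= pcounitE /= /scounit rmorphM.
Qed.
Definition smul : hom (c := cat) (prodc (scoalg : cat) (scoalg : cat)) scoalg :=
  @CoalgHom k (coalg_prod scoalg scoalg) scoalg (@calg_mult k _) smul_comul
    smul_counit.

Definition sone_fun (a : k^o) : O := calg_in (ab_obj G : calg k) a.
Lemma sone_linear : linear sone_fun.
Proof. by move=> a x y; rewrite /sone_fun rmorphD rmorphM. Qed.
HB.instance Definition _ :=
  GRing.isLinear.Build k k^o O *:%R sone_fun sone_linear.
Lemma sone_comul a : comul scoalg (sone_fun a) =
  tmap sone_fun sone_fun (comul (coalg_term k) a).
Proof.
rewrite /= /scomul /sone_fun calg_funE /kcomul linearZ /= tmapE /= /sone_fun
  rmorph1.
by rewrite -calg_tens_scale [RHS]mulr1.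
Qed.
Lemma sone_counit a : counit scoalg (sone_fun a) = counit (coalg_term k) a.
Proof. by rewrite /= /scounit /sone_fun calg_funE. Qed.
Definition sone : hom (c := cat) (term cat) scoalg :=
  @CoalgHom k (coalg_term k) scoalg sone_fun sone_comul sone_counit.

Lemma santipode_comul x : comul scoalg (santipode x) =
  tmap santipode santipode (comul scoalg x).
Proof.
have := congr1 (fun f => pull f x) (goppD (A := G) pr1 pr2).
rewrite {1}/gadd pair_pr compc1 /gopp /gadd -prodmap_pair pair_pr compc1.
by rewrite !pull_comp pull_prodmap.
Qed.
Lemma santipode_counit x : counit scoalg (santipode x) = counit scoalg x.
Proof.
have := gopp_uniq (gadd0 (gzero G (term (AffSchCat k)))).
have -> : gzero G (term (AffSchCat k)) = ab_zero G.
  by rewrite /gzero -(bang_uniq (idc _)) compc1.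
by move/(congr1 (fun f => pull f x)).
Qed.
Definition santi : hom (c := cat) scoalg scoalg :=
  @CoalgHom k scoalg scoalg santipode santipode_comul santipode_counit.

(** Under this reading of coalgebra maps as linear maps into an algebra, the sum
    of two points of the Hopf algebra becomes their convolution. *)
Definition slin (Z : cat) (x : hom Z (scoalg : cat)) :
  {linear (Z : coalg k) -> calg_mod (ab_obj G)} :=
  coalg_fun x.
Lemma slin_inj (Z : cat) : injective (@slin Z).
Proof.
move=> x y xy; apply: coalgHom_eq => z.
exact: (congr1 (fun f : {linear _ -> calg_mod (ab_obj G)} => f z) xy).
Qed.

Let add (Z : cat) (x y : hom Z (scoalg : cat)) : hom Z (scoalg : cat) :=
  smul \oc pairc x y.
Let zero (Z : cat) : hom Z (scoalg : cat) := sone \oc bang Z.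
Let opp (Z : cat) (x : hom Z (scoalg : cat)) : hom Z (scoalg : cat) :=
  santi \oc x.

Let slin_add Z (x y : hom Z (scoalg : cat)) :
  slin (add x y) = conv (slin x) (slin y).
Proof. exact: linear_eq. Qed.
Let slin_zero Z : slin (zero Z) = cunit Z (ab_obj G).
Proof. exact: linear_eq. Qed.

Let add_comp (Y Z : cat) (x y : hom Z (scoalg : cat)) (h : hom Y Z) :
  add x y \oc h = add (x \oc h) (y \oc h).
Proof. by rewrite /add -compcA pair_comp. Qed.
Let zero_comp (Y Z : cat) (h : hom Y Z) : zero Z \oc h = zero Y.
Proof. by rewrite /zero -compcA bang_comp. Qed.
Let addA Z : associative (@add Z).
Proof. by move=> x y z; apply: slin_inj; rewrite !slin_add convA. Qed.
Let addC Z : commutative (@add Z).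
Proof. by move=> x y; apply: slin_inj; rewrite !slin_add convC. Qed.
Let add0 Z : left_id (zero Z) (@add Z).
Proof. by move=> x; apply: slin_inj; rewrite !slin_add slin_zero conv1. Qed.
Let addN Z : left_inverse (zero Z) (@opp Z) (@add Z).
Proof.
move=> x; rewrite -[X in add _ X]comp1c -add_comp -[RHS](zero_comp x).
rewrite -[santi]compc1; congr (_ \oc _); apply: coalgHom_eq => c.
have := congr1 (fun f => pull f c) (ab_addN G); rewrite pull_comp => E.
apply: etrans E; rewrite [LHS]/= /cpair /= -/(scomul c).
elim/tensor_ind: (scomul c) => [y z|y z ey ez].
  by rewrite tmapE /= calg_multE [RHS]copairE.
by rewrite !linearD /= ey ez; symmetry; apply: (rmorphD (pull (pairc _ _))).
Qed.

Definition hopf_of : Hopf k :=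
  abGroup_of add_comp zero_comp addA addC add0 addN.

Lemma slin_gadd (Z : cat) (x y : hom Z (scoalg : cat)) :
  slin (gadd (A := hopf_of) x y) = conv (slin x) (slin y).
Proof. by rewrite abGroup_of_gadd slin_add. Qed.

Lemma hopf_of_add : ab_add hopf_of = smul.
Proof. by rewrite -[RHS]compc1 -pair_pr. Qed.

Lemma hopf_of_zero : ab_zero hopf_of = sone.
Proof. by rewrite -[RHS]compc1 (bang_uniq (idc _)). Qed.

End HopfOfGroupScheme.

(** * The commutative algebra underlying a Hopf algebra *)

Section CoalgebraProducts.
Variable k : fieldType.
Local Notation cat := (CoalgCat k).

Definition ceval (C D : cat) (f : hom C D) :
  {linear (C : coalg k) -> (D : coalg k)} :=
  coalg_fun f.

Lemma ceval_eq (C D : cat) (f g : hom C D) :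
  f = g -> forall x : (C : coalg k), ceval f x = ceval g x.
Proof. by move->. Qed.

Lemma ceval_comp (C D E : cat) (g : hom D E) (f : hom C D) x :
  ceval (g \oc f) x = ceval g (ceval f x).
Proof. by []. Qed.

Lemma ceval_pairc (Z C D : cat) (f : hom Z C) (g : hom Z D) z :
  ceval (pairc f g) z = tmap (ceval f) (ceval g) (comul Z z).
Proof. by []. Qed.

(** Morphisms of pairs act on pure tensors as expected; the computation is
    avoided by factoring through [pairc pr1 pr2], which is the identity. *)
Lemma ceval_prodmap (C D C' D' : cat) (f : hom C C') (g : hom D D') t :
  ceval (prodmap f g) t = tmap (ceval f) (ceval g) t.
Proof.
have {2}<- : ceval (pairc pr1 pr2) t = t by rewrite pair_pr.
by rewrite !ceval_pairc tmap_comp; apply: tmap_eq.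
Qed.

Lemma ceval_prodswap (C D : cat) (c : C : coalg k) (d : D : coalg k) :
  ceval (prodswap C D) (c *t d) = d *t c.
Proof.
have L t s : tmap (ceval (@pr2 _ C D)) (ceval (@pr1 _ C D)) (tmid (t *t s)) =
    tunit (tmap (counit D) (W := D) idfun (tswap s)) *t
    tunit (tmap (counit C) (W := C) idfun t).
  elim/tensor_ind: t => [t t'|t t']; last first.
    by rewrite !(tensE, linearD) /= => -> ->.
  elim/tensor_ind: s => [s s'|s s']; last first.
    by rewrite !(tensE, linearD) /= => -> ->.
  by rewrite tmidE !(tmapE, tswapE) /= cpr1E cpr2E !tunitE !tensE !scalerA
    mulrC.
by rewrite ceval_pairc /= pcomulE L counitr counitl.
Qed.

Lemma ceval_prodassoc (C D E : cat) (c : C : coalg k) (d : D : coalg k)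
  (e : E : coalg k) :
  ceval (prodassoc C D E) (c *t d *t e) = c *t (d *t e).
Proof.
have P (t : C \tens C) (s : D \tens D) (u : E \tens E) :
    tmap (ceval (@pr1 _ C D \oc @pr1 _ (prodc C D) E))
         (ceval (prodmap (@pr2 _ C D) (idc E))) (tmid (tmid (t *t s) *t u)) =
    tunit (tmap (counit C) (W := C) idfun (tswap t)) *t
    (tunit (tmap (counit D) (W := D) idfun s) *t
     tunit (tmap (counit E) (W := E) idfun u)).
  elim/tensor_ind: t => [t t'|t t']; last first.
    by rewrite !(tensE, linearD) /= => -> ->.
  elim/tensor_ind: s => [s s'|s s']; last first.
    by rewrite !(tensE, linearD) /= => -> ->.
  elim/tensor_ind: u => [u u'|u u']; last first.
    by rewrite !(tensE, linearD) /= => -> ->.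
  rewrite !tmidE [LHS]tmapE ceval_prodmap !(tmapE, tswapE) /= !cpr1E linearZ /=
    cpr1E cpr2E.
  by rewrite !tunitE !tensE !scalerA; congr (_ *: _);
    rewrite mulrC mulrA mulrAC.
have -> : prodassoc C D E = pairc (pr1 \oc pr1) (prodmap pr2 (idc E)).
  by rewrite /prodassoc /prodmap comp1c.
rewrite ceval_pairc [comul _ _]pcomulE [comul (prodc C D) _]pcomulE P.
by rewrite counitr !counitl.
Qed.

End CoalgebraProducts.

Section HopfAlgebra.
Variables (k : fieldType) (B : Hopf k).
Local Notation cat := (CoalgCat k).
Local Notation C := (ab_obj B : coalg k).

(** The multiplication is the group law of [B] on pure tensors. The scalars of
    [calg_mod halg] act through [hin], not by the scaling of [C], whence the
    identity maps [hlin] and [hlinV]. *)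
Definition hring : Type := C.
HB.instance Definition _ := GRing.Zmodule.on hring.

Definition hmul (x y : hring) : hring := ceval (ab_add B) ((x : C) *t (y : C)).
Definition hone : hring := ceval (ab_zero B) (1 : k^o).

Lemma hmulA : associative hmul.
Proof.
move=> x y z.
have := ceval_eq (ab_addA B) ((x : C) *t (y : C) *t (z : C)).
rewrite !ceval_comp !ceval_prodmap ceval_prodassoc !tmapE /= => E.
exact: esym E.
Qed.
Lemma hmulC : commutative hmul.
Proof.
move=> x y; have := ceval_eq (ab_addC B) ((x : C) *t (y : C)).
by rewrite ceval_comp ceval_prodswap => E; exact: esym E.
Qed.
Lemma hmul1 : left_id hone hmul.
Proof.
move=> x; have := ceval_eq (ab_add0 B) (x : C).
rewrite ceval_comp ceval_pairc => E; apply: etrans E.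
rewrite -[in LHS](counitl (x : C)).
elim/tensor_ind: (comul C x) => [y z|y z ey ez].
  rewrite !tmapE tunitE /hmul tensZr -tensZl /hone -linearZ /=.
  by rewrite [_ *: 1]mulr1.
rewrite !linearD /= -ey -ez /hmul tensDr; exact: linearD.
Qed.
Lemma hmulDl : left_distributive hmul +%R.
Proof. by move=> x y z; rewrite /hmul tensDl linearD. Qed.
HB.instance Definition _ :=
  GRing.Zmodule_isComPzRing.Build hring hmulA hmulC hmul1 hmulDl.

Definition hin (a : k) : hring := a *: (hone : C).
Lemma hin_zmod : zmod_morphism hin.
Proof. by move=> a b; apply: scalerBl. Qed.
Lemma hin_mul a (x : hring) : hin a * x = a *: (x : C).
Proof.
by rewrite -[x in RHS]mul1r -[LHS]/(hmul _ _) /hmul /hin tensZl linearZ.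
Qed.
Lemma hin_monoid : monoid_morphism hin.
Proof.
split; first by rewrite /hin scale1r.
by move=> a b; rewrite hin_mul /hin scalerA.
Qed.
HB.instance Definition _ := GRing.isZmodMorphism.Build k hring hin hin_zmod.
HB.instance Definition _ := GRing.isMonoidMorphism.Build k hring hin hin_monoid.

Definition halg : calg k := @Calg k hring hin.

Definition hlin_fun (x : C) : calg_mod halg := x.
Lemma hlin_linear : linear hlin_fun.
Proof. by move=> a x y; rewrite calg_scaleE [calg_in _ _ * _]hin_mul. Qed.
HB.instance Definition _ :=
  GRing.isLinear.Build k C (calg_mod halg) *:%R hlin_fun hlin_linear.
Definition hlin : {linear C -> calg_mod halg} := hlin_fun.

Definition hlinV_fun (x : calg_mod halg) : C := x.
Lemma hlinV_linear : linear hlinV_fun.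
Proof. by move=> a x y; rewrite calg_scaleE [calg_in _ _ * _]hin_mul. Qed.
HB.instance Definition _ :=
  GRing.isLinear.Build k (calg_mod halg) C *:%R hlinV_fun hlinV_linear.
Definition hlinV : {linear calg_mod halg -> C} := hlinV_fun.

Lemma hlin_mul t : calg_mult (tmap hlin hlin t) = hlin (ceval (ab_add B) t).
Proof.
elim/tensor_ind: t => [x y|x y ex ey]; last by rewrite !linearD /= ex ey.
by rewrite tmapE calg_multE.
Qed.

(** Points of [B] add up by convolution, because the group law is the
    multiplication of [halg]. *)
Lemma precomp_hlin_gadd (Z : cat) (x y : hom Z (ab_obj B)) :
  precomp hlin (gadd x y) = conv (precomp hlin x) (precomp hlin y).
Proof.
apply: linear_eq => z; rewrite convE.
have -> : tmap (precomp hlin x) (precomp hlin y) (comul Z z) =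
    tmap hlin hlin (tmap (ceval x) (ceval y) (comul Z z)).
  by rewrite tmap_comp; apply: tmap_eq.
by rewrite hlin_mul -ceval_pairc.
Qed.

Lemma precomp_hlin_gzero (Z : cat) : precomp hlin (gzero B Z) = cunit Z halg.
Proof.
apply: linear_eq => z; transitivity ((counit Z z : k) *: (hone : C));
  last by [].
by rewrite /hone -linearZ /= [_ *: 1]mulr1.
Qed.

(** The comultiplication and the counit are algebra maps, because the
    multiplication and the unit are coalgebra maps. *)
Definition hcomul_fun (x : hring) : talg halg halg :=
  tmap hlin hlin (comul C x).

Lemma hcomul_zmod : zmod_morphism hcomul_fun.
Proof. by move=> x y; rewrite /hcomul_fun !linearB. Qed.
Lemma hcomul_monoid : monoid_morphism hcomul_fun.
Proof.
split.
  rewrite /hcomul_fun -[1]/hone /hone /ceval coalg_comul /= /kcomul scale1r.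
  by rewrite !tmapE.
move=> x y; rewrite /hcomul_fun -[x * y]/(hmul _ _) /hmul /ceval coalg_comul.
rewrite [comul (coalg_prod C C) _]pcomulE.
elim/tensor_ind: (comul C x) => [x1 x2|x1 x2 e1 e2]; last first.
  by rewrite !(tensE, linearD) /= mulrDl e1 e2.
elim/tensor_ind: (comul C y) => [y1 y2|y1 y2 e1 e2]; last first.
  by rewrite !(tensE, linearD) /= mulrDr e1 e2.
by rewrite tmidE !tmapE /= [RHS]talg_mulE.
Qed.
HB.instance Definition _ :=
  GRing.isZmodMorphism.Build hring (talg halg halg) hcomul_fun hcomul_zmod.
HB.instance Definition _ :=
  GRing.isMonoidMorphism.Build hring (talg halg halg) hcomul_fun hcomul_monoid.
Lemma hcomul_in a : hcomul_fun (calg_in halg a) =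
  calg_in (calg_tens halg halg) a.
Proof.
rewrite -[calg_in halg a]/(hin a) /hin /hcomul_fun !linearZ /=.
rewrite -[RHS]mulr1 calg_tens_scale; congr (_ *: _).
exact: (rmorph1 hcomul_fun).
Qed.
Definition hcomul : calgHom halg (calg_tens halg halg) :=
  @CalgHom k halg (calg_tens halg halg) hcomul_fun hcomul_in.

Definition hcounit_fun (x : hring) : k := counit C x.
Lemma hcounit_zmod : zmod_morphism hcounit_fun.
Proof. by move=> x y; rewrite /hcounit_fun linearB. Qed.
Lemma hcounit_monoid : monoid_morphism hcounit_fun.
Proof.
split; first by rewrite /hcounit_fun -[1]/hone /hone /ceval coalg_counit.
move=> x y; rewrite /hcounit_fun -[x * y]/(hmul _ _) /hmul /ceval coalg_counit.
exact: pcounitE.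
Qed.
HB.instance Definition _ :=
  GRing.isZmodMorphism.Build hring k hcounit_fun hcounit_zmod.
HB.instance Definition _ :=
  GRing.isMonoidMorphism.Build hring k hcounit_fun hcounit_monoid.
Lemma hcounit_in a : hcounit_fun (calg_in halg a) = calg_in (calg_k k) a.
Proof.
rewrite -[calg_in halg a]/(hin a) /hin /hcounit_fun linearZ /=.
by have := rmorph1 hcounit_fun; rewrite /hcounit_fun => ->;
  rewrite [_ *: 1]mulr1.
Qed.
Definition hcounit : calgHom halg (calg_k k) :=
  @CalgHom k halg (calg_k k) hcounit_fun hcounit_in.

End HopfAlgebra.

(** * Tensor products of Hopf algebras *)

Section HopfTensor.
Variable k : fieldType.
Local Notation cat := (CoalgCat k).
Local Notation aff := (AffSchCat k).
Variables A A' : Hopf k.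
Let X : cat := prodc (ab_obj A) (ab_obj A').

(** Bilinearity for a linear map with values in an algebra, expressed on points
    with convolution as addition. The last two conditions do not follow from the
    first two, since a linear map may be idempotent for convolution without
    being the unit: the zero map satisfies the first two. *)
Definition pairing (R : calg k) (f : {linear (X : coalg k) -> calg_mod R}) :
  Prop :=
  forall Z : cat,
  [/\ forall (x1 x2 : hom Z (ab_obj A)) (y : hom Z (ab_obj A')),
        precomp f (pairc (gadd x1 x2) y) =
          conv (precomp f (pairc x1 y)) (precomp f (pairc x2 y)),
      forall (x : hom Z (ab_obj A)) (y1 y2 : hom Z (ab_obj A')),
        precomp f (pairc x (gadd y1 y2)) =
          conv (precomp f (pairc x y1)) (precomp f (pairc x y2)),
      forall y : hom Z (ab_obj A'), precomp f (pairc (gzero A Z) y) =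
        cunit Z R &
      forall x : hom Z (ab_obj A), precomp f (pairc x (gzero A' Z)) =
        cunit Z R].

Lemma pairing_postcomp (R S : calg k) (phi : calgHom R S) f :
  pairing f -> pairing (postcomp phi f).
Proof.
move=> fP Z; have [fl fr f0l f0r] := fP Z.
by split=> *;
  rewrite -!postcomp_precomp (fl, fr, f0l, f0r)
    ?(postcomp_conv, postcomp_cunit).
Qed.

Lemma pairing_cunit (R : calg k) : pairing (cunit (X : coalg k) R).
Proof. by move=> Z; split=> *; rewrite !precomp_cunit ?conv1. Qed.

Lemma pairing_conv (R : calg k) (f g : {linear (X : coalg k) -> calg_mod R}) :
  pairing f -> pairing g -> pairing (conv f g).
Proof.
move=> fP gP Z; have [fl fr f0l f0r] := fP Z; have [gl gr g0l g0r] := gP Z.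
split=> *; rewrite !precomp_conv.
- by rewrite fl gl convACA.
- by rewrite fr gr convACA.
- by rewrite f0l g0l conv1.
- by rewrite f0r g0r conv1.
Qed.

(* The morphism [(x, y) |-> (- x, y)], which gives the inverse of a pairing. *)
Let negl : hom X X := pairc (gopp pr1) pr2.
Let negl_pair Z (x : hom Z (ab_obj A)) (y : hom Z (ab_obj A')) :
  negl \oc pairc x y = pairc (gopp x) y.
Proof. by rewrite pair_comp /gopp -compcA pr1_pair pr2_pair. Qed.

Lemma pairing_opp (R : calg k) (f : {linear (X : coalg k) -> calg_mod R}) :
  pairing f -> pairing (precomp f negl).
Proof.
move=> fP Z; have [fl fr f0l f0r] := fP Z.
split=> *; rewrite -!precomp_comp !negl_pair ?goppD //.
have -> : gopp (gzero A Z) = gzero A Z by symmetry; apply: gopp_uniq;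
  rewrite gadd0.
exact: f0l.
Qed.

Lemma pairing_convN (R : calg k) (f : {linear (X : coalg k) -> calg_mod R}) :
  pairing f -> conv (precomp f negl) f = cunit (X : coalg k) R.
Proof.
move=> fP; have [fl _ f0l _] := fP X.
have e : f = precomp f (pairc pr1 pr2 : hom X X) by rewrite pair_pr precomp_id.
by rewrite {2}e -fl gaddN.
Qed.

(* The universal pairing *)
Definition pairing_alg : calg k := ualg pairing.
Definition pairing_gen : {linear (X : coalg k) -> calg_mod pairing_alg} :=
  @ugen k _ pairing.

Lemma postcomp_gen R (f : {linear (X : coalg k) -> calg_mod R})
  (fP : pairing f) :
  postcomp (uev fP) pairing_gen = f.
Proof. by apply: linear_eq => x; apply: uev_gen. Qed.

Lemma postcomp_ext R (g h : calgHom pairing_alg R) :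
  postcomp g pairing_gen = postcomp h pairing_gen -> g = h.
Proof.
move=> gh; apply: ualg_ext => v.
exact: (congr1 (fun f : {linear _ -> calg_mod R} => f v) gh).
Qed.

Lemma postcomp_sep (Z : coalg k) (u v : {linear Z -> calg_mod pairing_alg}) :
  (forall R (f : {linear (X : coalg k) -> calg_mod R}) (fP : pairing f),
     postcomp (uev fP) u = postcomp (uev fP) v) -> u = v.
Proof.
move=> uv; apply: linear_eq => z; apply: ualg_sep => R f fP.
exact: (congr1 (fun f : {linear _ -> calg_mod R} => f z) (uv R f fP)).
Qed.

Lemma pairing_genP : pairing pairing_gen.
Proof.
move=> Z; split=> *; apply: postcomp_sep => R f fP;
  have [fl fr f0l f0r] := fP Z;
  rewrite ?(postcomp_conv, postcomp_cunit) !postcomp_precomp postcomp_gen.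
- exact: fl.
- exact: fr.
- exact: f0l.
- exact: f0r.
Qed.

(* Morphisms from [Z] to the spectrum of [pairing_alg] are the same as pairings
   with values in the functions on [Z]; convolution makes them a group. *)
Let T : aff := pairing_alg.
Let gen (Z : aff) (x : hom Z T) :
  {linear (X : coalg k) -> calg_mod (Z : calg k)} :=
  postcomp (pull x) pairing_gen.
Let genP Z (x : hom Z T) : pairing (gen x).
Proof. exact: pairing_postcomp pairing_genP. Qed.
Let gen_inj Z : injective (@gen Z).
Proof. exact: postcomp_ext. Qed.
Let gen_comp Y Z (x : hom Z T) (h : hom Y Z) :
  gen (x \oc h) = postcomp (pull h) (gen x).
Proof. exact: linear_eq. Qed.

Let add (Z : aff) (x y : hom Z T) : hom Z T :=
  uev (pairing_conv (genP x) (genP y)).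
Let zero (Z : aff) : hom Z T := uev (@pairing_cunit Z).
Let opp (Z : aff) (x : hom Z T) : hom Z T := uev (pairing_opp (genP x)).

Let gen_add Z (x y : hom Z T) : gen (add x y) = conv (gen x) (gen y).
Proof. exact: postcomp_gen. Qed.
Let gen_zero Z : gen (zero Z) = cunit (X : coalg k) Z.
Proof. exact: postcomp_gen. Qed.
Let gen_opp Z (x : hom Z T) : gen (opp x) = precomp (gen x) negl.
Proof. exact: postcomp_gen. Qed.

Let add_comp (Y Z : aff) (x y : hom Z T) (h : hom Y Z) :
  add x y \oc h = add (x \oc h) (y \oc h).
Proof.
by apply: gen_inj; rewrite gen_comp !gen_add postcomp_conv -!gen_comp.
Qed.
Let zero_comp (Y Z : aff) (h : hom Y Z) : zero Z \oc h = zero Y.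
Proof. by apply: gen_inj; rewrite gen_comp !gen_zero postcomp_cunit. Qed.
Let addA Z : associative (@add Z).
Proof. by move=> x y z; apply: gen_inj; rewrite !gen_add convA. Qed.
Let addC Z : commutative (@add Z).
Proof. by move=> x y; apply: gen_inj; rewrite !gen_add convC. Qed.
Let add0 Z : left_id (zero Z) (@add Z).
Proof. by move=> x; apply: gen_inj; rewrite !gen_add gen_zero conv1. Qed.
Let addN Z : left_inverse (zero Z) (@opp Z) (@add Z).
Proof.
by move=> x; apply: gen_inj; rewrite !gen_add gen_opp gen_zero pairing_convN.
Qed.

Definition pairing_scheme : AbSch k :=
  abGroup_of add_comp zero_comp addA addC add0 addN.
Definition hopf_tensor : Hopf k := hopf_of pairing_scheme.

(** The comultiplication of [hopf_tensor] is the convolution of the two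
    inclusions, so it sends a generator [t] to the sum of the [t_1 (x) t_2]: the
    generators form a coalgebra map. *)
Lemma pairing_gen_comul x :
  comul (ab_obj hopf_tensor : coalg k) (pairing_gen x) =
  tmap pairing_gen pairing_gen (comul X x).
Proof.
have -> : comul (ab_obj hopf_tensor : coalg k) (pairing_gen x) =
    conv (gen (@pr1 aff T T)) (gen (@pr2 aff T T)) x.
  by rewrite -gen_add.
rewrite convE; elim/tensor_ind: (comul X x) => [y z|y z ey ez].
  by rewrite !tmapE calg_multE [LHS]talg_mulE mulr1 mul1r.
by rewrite !linearD /= -ey -ez.
Qed.
Lemma pairing_gen_counit x :
  counit (ab_obj hopf_tensor : coalg k) (pairing_gen x) =
    counit (X : coalg k) x.
Proof.
have -> : counit (ab_obj hopf_tensor : coalg k) (pairing_gen x) =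
  gen (zero (term aff)) x by [].
by rewrite gen_zero.
Qed.
Definition hopf_tensor_hom : hom X (ab_obj hopf_tensor : cat) :=
  @CoalgHom k X (ab_obj hopf_tensor : coalg k) pairing_gen pairing_gen_comul
    pairing_gen_counit.

Let slin_tens (Z : cat) (h : hom Z X) :
  slin (G := pairing_scheme) (hopf_tensor_hom \oc h) = precomp pairing_gen h.
Proof. exact: linear_eq. Qed.

Lemma hopf_tensor_homP : bilinear_hom (B := hopf_tensor) hopf_tensor_hom.
Proof.
move=> Z; have [fl fr _ _] := pairing_genP Z.
by split=> *; apply: slin_inj; rewrite slin_gadd !slin_tens (fl, fr).
Qed.
Definition hopf_tensor_bil : Bil A A' hopf_tensor := MkBil hopf_tensor_homP.

Section Extension.
Variables (B : Hopf k) (b : Bil A A' B).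

Let f : {linear (X : coalg k) -> calg_mod (halg B)} :=
  precomp (hlin B) (bil_hom b).

Lemma bil_pairing : pairing f.
Proof.
move=> Z; have [bl br] := bil_homP b Z.
split=> *; rewrite -!precomp_comp.
- by rewrite bl precomp_hlin_gadd.
- by rewrite br precomp_hlin_gadd.
- by rewrite bil0l precomp_hlin_gzero.
- by rewrite bil0r precomp_hlin_gzero.
Qed.

Let ev : calgHom pairing_alg (halg B) := uev bil_pairing.
Let C : coalg k := ab_obj B.


Let ev_gen : gen (ev : hom (halg B : aff) T) = f.
Proof. exact: postcomp_gen. Qed.

(* Both sides are algebra maps, so it suffices to compare them on generators,
   where they agree because [b] is a coalgebra map. *)
Let ev_comul : calg_comp (hcomul B) ev =
  pull (ab_add pairing_scheme \oc prodmap (ev : hom (halg B : aff) T)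
    (ev : hom (halg B : aff) T)).
Proof.
apply: postcomp_ext; rewrite -[RHS]/(gen _).
rewrite -[ab_add _ \oc _]/(gadd (A := pairing_scheme) _ _) abGroup_of_gadd
  gen_add !gen_comp ev_gen.
have -> : postcomp (calg_comp (hcomul B) ev) pairing_gen =
  postcomp (hcomul B) f by rewrite -ev_gen; apply: linear_eq.
apply: linear_eq => x; rewrite convE.
have -> : postcomp (hcomul B) f x = tmap f f (comul X x).
  transitivity (tmap (hlin B) (hlin B) (comul C (coalg_fun (bil_hom b) x)));
    first by [].
  by rewrite coalg_comul tmap_comp; apply: tmap_eq.
elim/tensor_ind: (comul X x) => [y z|y z ey ez];
  last by rewrite !linearD /= ey ez.
by rewrite !tmapE calg_multE [RHS]talg_mulE mul1r mulr1.
Qed.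

Let ev_counit : calg_comp (hcounit B) ev = pull (ab_zero pairing_scheme).
Proof.
apply: postcomp_ext; rewrite -[RHS]/(gen (zero _)) gen_zero.
apply: linear_eq => x; transitivity (counit C (coalg_fun (bil_hom b) x)).
  by rewrite -[coalg_fun _ x]/(f x) -ev_gen.
exact: coalg_counit.
Qed.

Definition hext : {linear (ab_obj hopf_tensor : coalg k) -> C} :=
  hlinV B \o clin ev.

Lemma hext_comul x :
  comul C (hext x) = tmap hext hext (comul (ab_obj hopf_tensor : coalg k) x).
Proof.
have : hcomul_fun (ev x) =
  pull (prodmap (ev : hom (halg B : aff) T) (ev : hom (halg B : aff) T))
    (pull (ab_add pairing_scheme) x).
  by rewrite -pull_comp -ev_comul.
rewrite pull_prodmap.
move/(congr1 (tmap (hlinV B) (hlinV B))); rewrite [in RHS]tmap_comp => E.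
apply: etrans E; rewrite [X in tmap _ _ X]/= /hcomul_fun tmap_comp.
by rewrite -[LHS]tmap_id; apply: tmap_eq.
Qed.
Lemma hext_counit x : counit C (hext x) =
  counit (ab_obj hopf_tensor : coalg k) x.
Proof. exact: (congr1 (fun g : calgHom _ _ => g x) ev_counit). Qed.
Definition hext_coalg : hom (ab_obj hopf_tensor : cat) (ab_obj B) :=
  @CoalgHom k (ab_obj hopf_tensor : coalg k) C hext hext_comul hext_counit.

Lemma hext_homD : hext_coalg \oc ab_add hopf_tensor =
  ab_add B \oc prodmap hext_coalg hext_coalg.
Proof.
rewrite hopf_of_add; apply: coalgHom_eq => t.
rewrite -[RHS]/(ceval (ab_add B) (ceval (prodmap hext_coalg hext_coalg) t)).
rewrite ceval_prodmap; move: t.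
apply: (@tensor_ext _ _ _ _ (ceval (hext_coalg \oc smul pairing_scheme))
  (ceval (ab_add B) \o tmap (ceval hext_coalg) (ceval hext_coalg))) => x y.
rewrite ceval_comp [ceval (smul _) _]calg_multE [RHS]/= tmapE.
exact: (rmorphM ev).
Qed.
Definition hext_hom : abHom hopf_tensor B := AbHom hext_homD.

Lemma hext_restr : hext_coalg \oc hopf_tensor_hom = bil_hom b.
Proof.
apply: coalgHom_eq => x.
exact: (congr1 (fun g : {linear _ -> calg_mod (halg B)} => g x) ev_gen).
Qed.

End Extension.

(** A homomorphism out of the tensor product preserves products and constants,
    as these are the sum and the zero of its points; it is therefore determined
    by its values on the generators. *)
Section Restriction.
Variables (B : Hopf k) (g : abHom hopf_tensor B).
Definition halg_of (x : pairing_alg) : halg B := coalg_fun (ab_hom g) x.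
Lemma halg_of_mul x y : halg_of (x * y) = halg_of x * halg_of y.
Proof.
have := ceval_eq (ab_homD g)
  ((x : (ab_obj hopf_tensor : coalg k)) *t
    (y : (ab_obj hopf_tensor : coalg k))).
rewrite hopf_of_add !ceval_comp ceval_prodmap tmapE.
by rewrite [ceval (smul _) _]calg_multE.
Qed.
Lemma halg_of_in a : halg_of (calg_in pairing_alg a) = calg_in (halg B) a.
Proof.
have := ceval_eq (abHom_gzero g (term cat)) (a : k^o).
rewrite /gzero -(bang_uniq (idc _)) !compc1 hopf_of_zero ceval_comp => E.
apply: etrans E _; rewrite -[RHS]/(hin B a) /hin /hone -linearZ /=.
by rewrite [_ *: 1]mulr1.
Qed.
Lemma halg_of_zmod : zmod_morphism halg_of.
Proof. exact: (linearB (coalg_fun (ab_hom g))). Qed.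
Lemma halg_of_monoid : monoid_morphism halg_of.
Proof.
split; last exact: halg_of_mul.
by rewrite -(rmorph1 (calg_in pairing_alg)) halg_of_in rmorph1.
Qed.
HB.instance Definition _ :=
  GRing.isZmodMorphism.Build (pairing_alg : comPzRingType) (halg B) halg_of
    halg_of_zmod.
HB.instance Definition _ :=
  GRing.isMonoidMorphism.Build (pairing_alg : comPzRingType) (halg B) halg_of
    halg_of_monoid.
Definition halg_hom : calgHom pairing_alg (halg B) :=
  @CalgHom k pairing_alg (halg B) halg_of halg_of_in.
End Restriction.

Theorem hopf_tensor_product : is_tensor_product hopf_tensor_bil.
Proof.
move=> B; exists (fun b => hext_hom b) => [g|b]; last first.
  by apply: Bil_eq; apply: hext_restr.
apply: abHom_eq; set b := bil_comp g hopf_tensor_bil.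
have E : halg_hom (hext_hom b) = halg_hom g.
  apply: postcomp_ext; apply: linear_eq => x.
  exact: (congr1 (fun h => ceval h x) (hext_restr b)).
apply: coalgHom_eq => x; exact: (congr1 (fun h : calgHom _ _ => h x) E).
Qed.

End HopfTensor.

Theorem theorem1p3 (k : fieldType) :
  (forall A A' : Hopf k,
     exists (T : Hopf k) (a : Bil A A' T), is_tensor_product a) /\
  (perfect_field k ->
   forall A A' : AbSch k,
     exists (T : AbSch k) (a : Bil A A' T), is_tensor_product a).
Proof.
split=> [A A'|_ A A'].
  by exists (hopf_tensor A A'), (hopf_tensor_bil A A');
    apply: hopf_tensor_product.
by exists (affine_tensor A A'), (affine_tensor_bil A A');
  apply: affine_tensor_product.
Qed.
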